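(* Let $V$ be a function analytic in a disc $\{z:|z|<R\}$ and taking positive values on the interval $(0,R)$. Define $s(z)=\exp\left(\int\frac{dz}{V(z)}\right)$ and $b(z)=\exp\left(\int\frac{z\,dz}{V(z)}\right)$ (with arbitrary fixed antiderivatives), and $\tau(z)=z/s(z)$. Suppose $\tau(0)>0$ and that the numbers $$c_0=b(0),\qquad c_k=\frac{1}{(k+1)!}\left(\frac{d}{dz}\right)^k\Big(b'(\tau(z))\,(\tau(z))^{k+1}\Big)\Big|_{z=0},\quad k=1,2,\dots$$ are all non-negative. Then $V$ is the covariance of the power series distribution of the function $\omega$ defined by $\omega(y)=b(z)$ where $y=s(z)$ (i.e. $\omega=b\circ s^{-1}$).
   Context: For a power series $\omega(y)=\sum_k a_ky^k$ with non-negative coefficients and positive radius of convergence, the power series distribution (PSD) of $\omega$ with parameter $y>0$ is the law on $\{0,1,2,\dots\}$ given by $P\{\xi=k\}=a_ky^k/\omega(y)$. Its mean is $x(y)=y\omega'(y)/\omega(y)$ and its variance is $y\,x'(y)>0$, so $x(\cdot)$ has an inverse $y=f(x)$ on its range. The covariance of the PSD of $\omega$ is the function $V(x)=f(x)/f'(x)$, i.e. the variance expressed as a function of the mean $x$. Here $\tau(0)$ denotes the value at $0$ of the (analytically extended) function $z/s(z)$.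
   Formalization: The formula for c_k is corrected: b'(z)τ(z)^{k+1} replaces b'(τ(z))τ(z)^{k+1}, which may be undefined (V=z−z², s=z/(1−z): τ(0)=1 is a pole of b). The corrected c_k are the Lagrange coefficients of ω=b∘s^{-1}. *)

(* Defs.v *)
From Stdlib Require Import Reals.
From Coquelicot Require Import Coquelicot.
Open Scope R_scope.

Definition psd_series (a : nat -> R) : Prop :=
  (forall n, 0 <= a n) /\ Rbar_lt (Finite 0) (CV_radius a).

Definition psd_mean (a : nat -> R) (y : R) : R :=
  y * Derive (PSeries a) y / PSeries a y.

(* "v is the value at x of the covariance of the PSD of omega = PSeries a":
   x lies in the range of the mean function y |-> x(y) (y in (0, radius)),
   and for the inverse f of the mean function (y = f(x)) one has
   V(x) = f(x) / f'(x).  The inverse is characterised by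
   f (x(y)) = y for all parameters y; any such f is meant. *)
Definition psd_covariance_at (a : nat -> R) (x v : R) : Prop :=
  (exists y, 0 < y /\ Rbar_lt (Finite y) (CV_radius a) /\ psd_mean a y = x) /\
  forall f : R -> R,
    (forall y, 0 < y -> Rbar_lt (Finite y) (CV_radius a) -> f (psd_mean a y) = y) ->
    ex_derive f x /\ v = f x / Derive f x.

(* Main.v *)
(* Put s = exp F and b = exp G. Since 1 / s' = V / s is analytic at 0, the coefficients
   a_k = (V / s d/dz)^k b (0) / k! are defined, the derivatives (d/ds)^k b are bounded by K (C k)^k,
   and a flatness estimate for functions with such bounds gives omega (s z) = b z near 0, where
   omega y = sum a_k y^k; by Lagrange's formula a_(k+1) = c_k for k >= 1, hence a_k >= 0
   (a_0 = b(0) and a_1 = tau(0) b(0)).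
   If omega (s z) = b z holds for z < z*, then near z* the derivatives
   omega^(k) (s z) = (d/ds)^k b (z) are again bounded by K (C k)^k; as the a_k are non-negative,
   Pringsheim's argument pushes the radius of convergence beyond s z*, and the flatness estimate
   extends the identity past z*. So it holds on (0, R). Differentiating it gives
   s omega'(s) / omega(s) = z: the inverse of the mean is s itself, and s / s' = V. *)
Require Import Defs.
From Stdlib Require Import Reals Factorial Lra Lia Psatz.
From Coquelicot Require Import Coquelicot.
Open Scope R_scope.

(** Everything stays on the real line, where sup norms do not control derivatives. Estimates
    therefore use the coefficient norms sum |a_n| r^n, which are submultiplicative and lose only a
    factor 1 / (r - r') under differentiation. Two obstacles shape the rest. F tends to -infinity at
    0, so the start at 0 works with s = z / t, where t is a power series. Further out the situation
    is reversed: s and b are given as power series only near 0, while V is one on the whole disc, so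
    (d/ds)^k b is divided by b / s^k, which leaves power series built from z and V alone. The
    flatness estimate takes the place of the identity theorem and never needs b as a power series in
    s. The comparison cannot start at z* itself, since s z* might lie on the boundary of the disc of
    convergence of omega; it starts slightly below, and uniform bounds there keep the gain in radius
    from shrinking as z tends to z*. *)

(** * Weighted coefficient norms and Cauchy estimates *)

(** Bounded partial sums instead of the value of a series: no convergence has to be proved
    beforehand, and r may be the radius of convergence itself. *)
Definition maj (a : nat -> R) (r M : R) : Prop :=
  forall N, sum_f_R0 (fun n => Rabs (a n) * r ^ n) N <= M.

Lemma sum_f_R0_nonneg (u : nat -> R) (N : nat) :
  (forall n, (n <= N)%nat -> 0 <= u n) -> 0 <= sum_f_R0 u N.
Proof.
  intros H.
  induction N as [|N IH]; simpl.
  - apply H; lia.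
  - apply Rplus_le_le_0_compat; [apply IH; intros; apply H; lia | apply H; lia].
Qed.

Lemma maj_nonneg a r M : maj a r M -> 0 <= M.
Proof.
  intros H. specialize (H 0%nat). simpl in H. pose proof (Rabs_pos (a 0%nat)). lra.
Qed.

Lemma maj_coef a r M n : 0 <= r -> maj a r M -> Rabs (a n) * r ^ n <= M.
Proof.
  intros Hr H. apply Rle_trans with (2 := H n).
  assert (Hp : forall k, 0 <= Rabs (a k) * r ^ k)
    by (intros k; apply Rmult_le_pos; [apply Rabs_pos | apply pow_le; lra]).
  destruct n as [|n]; simpl sum_f_R0; [lra|].
  assert (0 <= sum_f_R0 (fun k => Rabs (a k) * r ^ k) n)
    by (apply sum_f_R0_nonneg; intros; apply Hp).
  simpl in *; lra.
Qed.

Lemma maj_weaken a r M r' M' : 0 <= r' <= r -> M <= M' -> maj a r M -> maj a r' M'.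
Proof.
  intros Hr HM H N. apply Rle_trans with M; [|lra].
  apply Rle_trans with (2 := H N). apply sum_Rle. intros n _.
  apply Rmult_le_compat_l; [apply Rabs_pos | apply pow_incr; lra].
Qed.

Lemma maj_plus a b r A B : 0 <= r -> maj a r A -> maj b r B -> maj (PS_plus a b) r (A + B).
Proof.
  intros Hr HA HB N. specialize (HA N). specialize (HB N).
  apply Rle_trans with (2 := Rplus_le_compat _ _ _ _ HA HB).
  rewrite <- sum_plus. apply sum_Rle. intros n _.
  rewrite <- Rmult_plus_distr_r. apply Rmult_le_compat_r; [apply pow_le; lra|].
  apply Rabs_triang.
Qed.

(** What [cauchy_finite] leaves over, beyond the truncated Cauchy product, is non-negative. *)
Lemma maj_mult a b r A B : 0 <= r -> maj a r A -> maj b r B -> maj (PS_mult a b) r (A * B).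
Proof.
  intros Hr HA HB N.
  set (u := fun n => Rabs (a n) * r ^ n). set (w := fun n => Rabs (b n) * r ^ n).
  assert (Hu : forall n, 0 <= u n)
    by (intros; apply Rmult_le_pos; [apply Rabs_pos | apply pow_le; lra]).
  assert (Hw : forall n, 0 <= w n)
    by (intros; apply Rmult_le_pos; [apply Rabs_pos | apply pow_le; lra]).
  apply Rle_trans with (sum_f_R0 (fun k => sum_f_R0 (fun p => u p * w (k - p)%nat) k) N).
  - apply sum_Rle. intros n _. unfold PS_mult.
    apply Rle_trans with (sum_f_R0 (fun p => Rabs (a p * b (n - p)%nat)) n * r ^ n).
    + apply Rmult_le_compat_r; [apply pow_le; lra | apply Rsum_abs].
    + rewrite Rmult_comm, scal_sum. apply Req_le. apply sum_eq. intros p Hp.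
      unfold u, w. rewrite Rabs_mult. replace (r ^ n) with (r ^ p * r ^ (n - p)); [ring|].
      rewrite <- pow_add. f_equal. lia.
  - apply Rle_trans with (sum_f_R0 u N * sum_f_R0 w N).
    + destruct N as [|N]; [simpl; lra|].
      rewrite (cauchy_finite u w (S N)) by lia.
      match goal with |- _ <= _ + ?x => assert (0 <= x); [|lra] end.
      apply sum_f_R0_nonneg. intros k _. apply sum_f_R0_nonneg. intros l _.
      apply Rmult_le_pos; auto.
    + apply Rmult_le_compat; auto using sum_f_R0_nonneg.
Qed.

(** Convexity: the graph of x^(n+1) lies above its tangent at r'. This is the Cauchy estimate for a
    single monomial, from which [maj_derive] follows termwise. *)
Lemma pow_sub_ge (r' r : R) (n : nat) :
  0 <= r' -> r' <= r -> (r - r') * (INR (S n) * r' ^ n) <= r ^ S n - r' ^ S n.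
Proof.
  intros H0 H. induction n as [|n IH].
  - simpl. lra.
  - rewrite S_INR. assert (0 <= r' ^ S n) by (apply pow_le; lra).
    assert (r' ^ S n <= r ^ S n) by (apply pow_incr; lra).
    change (r ^ S (S n)) with (r * r ^ S n). change (r' ^ S (S n)) with (r' * r' ^ S n).
    replace ((r - r') * ((INR (S n) + 1) * r' ^ S n))
      with (r' * ((r - r') * (INR (S n) * r' ^ n)) + (r - r') * r' ^ S n)
      by (simpl pow; ring).
    nra.
Qed.

Lemma maj_derive a r r' A : 0 <= r' < r -> maj a r A -> maj (PS_derive a) r' (A / (r - r')).
Proof.
  intros Hr H N. apply Rmult_le_reg_l with (r - r'); [lra|].
  replace ((r - r') * (A / (r - r'))) with A by (field; lra).
  rewrite scal_sum.
  apply Rle_trans with (sum_f_R0 (fun n => Rabs (a (S n)) * r ^ S n) N).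
  - apply sum_Rle. intros n _. unfold PS_derive.
    rewrite Rabs_mult, (Rabs_pos_eq (INR (S n))) by apply pos_INR.
    assert (Hp := pow_sub_ge r' r n (proj1 Hr) (Rlt_le _ _ (proj2 Hr))).
    assert (0 <= r' ^ S n) by (apply pow_le; lra).
    replace (INR (S n) * Rabs (a (S n)) * r' ^ n * (r - r'))
      with (Rabs (a (S n)) * ((r - r') * (INR (S n) * r' ^ n))) by ring.
    apply Rmult_le_compat_l; [apply Rabs_pos | lra].
  - apply Rle_trans with (2 := H (S N)).
    rewrite (decomp_sum (fun n => Rabs (a n) * r ^ n) (S N)) by lia. simpl pred.
    pose proof (Rabs_pos (a 0%nat)). simpl (r ^ 0). lra.
Qed.

Lemma maj_radius a r M : 0 <= r -> maj a r M -> Rbar_le (Finite r) (CV_radius a).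
Proof.
  intros Hr H. apply (proj1 (CV_radius_bounded a)). exists M. intros n.
  rewrite Rabs_mult, (Rabs_pos_eq (r ^ n)) by (apply pow_le; lra).
  apply maj_coef with (1 := Hr) (2 := H).
Qed.

Lemma maj_inside a r M x : maj a r M -> Rabs x < r -> Rbar_lt (Finite (Rabs x)) (CV_radius a).
Proof.
  intros H Hx. apply Rbar_lt_le_trans with (Finite r); [exact Hx|].
  apply maj_radius with (2 := H). pose proof (Rabs_pos x). lra.
Qed.

Lemma maj_PSeries a r M x : maj a r M -> Rabs x < r -> Rabs (PSeries a x) <= M.
Proof.
  intros H Hx. assert (Hi := maj_inside _ _ _ _ H Hx).
  assert (He := CV_disk_inside _ _ Hi).
  unfold PSeries. apply Rle_trans with (Series (fun n => Rabs (a n * x ^ n))).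
  - apply Series_Rabs, He.
  - apply Series_correct in He.
    apply (is_lim_seq_le _ _ (Finite _) (Finite _)) with (2 := He) (3 := is_lim_seq_const M).
    intros N. rewrite sum_n_Reals. apply Rle_trans with (2 := H N).
    apply sum_Rle. intros n _. rewrite Rabs_mult, <- RPow_abs.
    apply Rmult_le_compat_l; [apply Rabs_pos | apply pow_incr; split; [apply Rabs_pos | lra]].
Qed.

Lemma maj_exists a r : 0 <= r -> Rbar_lt (Finite r) (CV_radius a) -> exists M, maj a r M.
Proof.
  intros Hr H. rewrite <- (Rabs_pos_eq r Hr) in H. apply CV_disk_inside in H.
  exists (Series (fun n => Rabs (a n * r ^ n))). intros N.
  apply Series_correct in H.
  assert (Hs : forall n, Rabs (a n) * r ^ n = Rabs (a n * r ^ n))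
    by (intros n; rewrite Rabs_mult, (Rabs_pos_eq (r ^ n)); [reflexivity | apply pow_le; lra]).
  rewrite (sum_eq _ (fun n => Rabs (a n * r ^ n))) by (intros; apply Hs).
  rewrite <- sum_n_Reals.
  apply (is_lim_seq_incr_compare (sum_n (fun n => Rabs (a n * r ^ n)))); [exact H|].
  intros n. rewrite sum_Sn. unfold plus; simpl. pose proof (Rabs_pos (a (S n) * (r * r ^ n))). lra.
Qed.

(* The step from radius r0 to r is split evenly among the N derivations. *)
Lemma maj_iterate (X : nat -> nat -> R) (r0 r M A : R) :
  0 <= r < r0 -> 0 <= A -> maj (X 0%nat) r0 M ->
  (forall k q q' B, 0 <= q' < q -> q <= r0 -> maj (X k) q B ->
     maj (X (S k)) q' ((A / (q - q') + A * INR (S k)) * B)) ->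
  exists C, 0 < C /\ forall N, maj (X N) r (M * (C * INR N) ^ N).
Proof.
  intros Hr HA H0 Hs. assert (HM := maj_nonneg _ _ _ H0).
  (* With d = (r0 - r) / N, a single derivation costs A / d + A (k + 1) <= C N for k < N. The
     summand 1 keeps C positive when A = 0. *)
  set (C := A / (r0 - r) + A + 1).
  assert (HC0 : 0 <= A / (r0 - r)) by (apply Rdiv_le_0_compat; lra).
  assert (HC : 0 < C) by (unfold C; lra).
  exists C. split; [exact HC|]. intros N.
  destruct N as [|N]; [simpl; apply maj_weaken with (3 := H0); lra|].
  assert (HN : 0 < INR (S N)) by (apply lt_0_INR; lia).
  set (d := (r0 - r) / INR (S N)).
  assert (Hd : 0 < d) by (apply Rdiv_lt_0_compat; lra).
  assert (HdN : INR (S N) * d = r0 - r) by (unfold d; field; lra).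
  assert (Hk : forall k, (k <= S N)%nat -> maj (X k) (r0 - INR k * d) (M * (C * INR (S N)) ^ k)).
  { intros k. induction k as [|k IH]; intros Hle.
    - simpl. apply maj_weaken with (3 := H0); lra.
    - assert (HSk : INR (S k) <= INR (S N)) by (apply le_INR; lia).
      assert (HINR : INR (S k) = INR k + 1) by apply S_INR.
      assert (0 <= INR k) by apply pos_INR.
      assert (Hq : INR (S k) * d <= r0 - r) by (rewrite <- HdN; apply Rmult_le_compat_r; lra).
      specialize (IH ltac:(lia)).
      assert (0 <= INR k * d) by (apply Rmult_le_pos; lra).
      assert (Hqq : 0 <= r0 - INR (S k) * d < r0 - INR k * d) by (split; [lra | rewrite HINR; lra]).
      assert (Hq0 : r0 - INR k * d <= r0) by lra.
      assert (IH' := Hs k _ _ _ Hqq Hq0 IH).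
      apply maj_weaken with (3 := IH'); [lra|].
      replace (r0 - INR k * d - (r0 - INR (S k) * d)) with d by (rewrite HINR; ring).
      replace (M * (C * INR (S N)) ^ S k) with (C * INR (S N) * (M * (C * INR (S N)) ^ k))
        by (simpl; ring).
      apply Rmult_le_compat_r.
      + apply Rmult_le_pos; [lra|]. apply pow_le, Rmult_le_pos; lra.
      + replace (A / d) with (A / (r0 - r) * INR (S N)) by (unfold d; field; lra).
        unfold C. nra. }
  specialize (Hk (S N) (le_n _)). rewrite HdN in Hk.
  replace (r0 - (r0 - r)) with r in Hk by ring. exact Hk.
Qed.

(** * Flatness from bounds on all derivatives *)

Lemma derive_nonneg_le (f df : R -> R) (a b : R) :
  a <= b -> (forall z, a <= z <= b -> is_derive f z (df z)) ->
  (forall z, a <= z <= b -> 0 <= df z) -> f a <= f b.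
Proof.
  intros Hab Hd Hp.
  destruct (MVT_gen f a b df) as (c & Hc & He).
  - intros x. rewrite Rmin_left, Rmax_right by lra. intros Hx. apply Hd. lra.
  - intros x. rewrite Rmin_left, Rmax_right by lra. intros Hx.
    apply continuity_pt_filterlim. apply (ex_derive_continuous f x).
    exists (df x). apply Hd, Hx.
  - rewrite Rmin_left, Rmax_right in Hc by lra.
    assert (0 <= df c * (b - a)) by (apply Rmult_le_pos; [apply Hp, Hc | lra]). lra.
Qed.

(** Induction with (1 + 1/m)^m <= exp 1 <= 3; this is the origin of the 3 in the later constants. *)
Lemma pow_self_le_fact (n : nat) : INR n ^ n <= 3 ^ n * INR (fact n).
Proof.
  induction n as [|n IH]; [simpl; lra|].
  destruct n as [|n]; [simpl; lra|].
  set (m := S n) in *. assert (Hm : 0 < INR m) by (apply lt_0_INR; unfold m; lia).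
  assert (He : (INR (S m)) ^ m <= 3 * INR m ^ m).
  { rewrite S_INR. replace (INR m + 1) with (INR m * (1 + / INR m)) by (field; lra).
    rewrite Rpow_mult_distr, Rmult_comm. apply Rmult_le_compat_r; [apply pow_le; lra|].
    apply Rle_trans with (exp (/ INR m) ^ m).
    - apply pow_incr. assert (0 < / INR m) by (apply Rinv_0_lt_compat; lra).
      split; [lra | apply exp_ineq1_le].
    - rewrite <- Rpower_pow by apply exp_pos. unfold Rpower. rewrite ln_exp, Rinv_r by lra.
      apply exp_le_3. }
  rewrite fact_simpl, mult_INR. change (INR (S m) ^ S m) with (INR (S m) * INR (S m) ^ m).
  change (3 ^ S m) with (3 * 3 ^ m). assert (0 <= INR (S m)) by apply pos_INR.
  replace (3 * 3 ^ m * (INR (S m) * INR (fact m)))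
    with (INR (S m) * (3 * (3 ^ m * INR (fact m)))) by ring.
  apply Rmult_le_compat_l; lra.
Qed.

(* Taylor's formula in the variable s: the remainder of order N is at most
   K (C N)^N (s z - s z0)^N / N!, which tends to 0. *)
Lemma flat_vanish (phi : nat -> R -> R) (s ds : R -> R) (z0 z1 K C : R) :
  0 <= K -> 0 <= C ->
  (forall k z, z0 <= z <= z1 -> is_derive (phi k) z (phi (S k) z * ds z)) ->
  (forall z, z0 <= z <= z1 -> is_derive s z (ds z)) ->
  (forall z, z0 <= z <= z1 -> 0 <= ds z) ->
  (forall k, phi k z0 = 0) ->
  (forall k z, z0 <= z <= z1 -> Rabs (phi k z) <= K * (C * INR k) ^ k) ->
  3 * C * (s z1 - s z0) < 1 ->
  forall z, z0 <= z <= z1 -> phi 0%nat z = 0.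
Proof.
  intros HK HC Hphi Hs Hds H0 Hb Hsm z Hz.
  assert (Hmon : forall x y, z0 <= x -> x <= y -> y <= z1 -> s x <= s y).
  { intros x y H1 H2 H3. apply derive_nonneg_le with ds; [lra | |]; intros t Ht;
    [apply Hs | apply Hds]; lra. }
  (* The bound on order N is integrated j times from z0, where all orders vanish; the j-th
     integration in s contributes a factor (s x - s z0) / j. *)
  assert (Hj : forall N j x, (j <= N)%nat -> z0 <= x <= z1 ->
    Rabs (phi (N - j)%nat x) <=
      K * (C * INR N) ^ N / INR (fact j) * (s x - s z0) ^ j).
  { intros N j. induction j as [|j IH]; intros x Hle Hx.
    - rewrite Nat.sub_0_r. simpl. replace (K * (C * INR N) ^ N / 1 * 1)
        with (K * (C * INR N) ^ N) by field. apply Hb, Hx.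
    - set (c := K * (C * INR N) ^ N / INR (fact (S j))).
      assert (Hf := INR_fact_lt_0 j). assert (HSj : 0 < INR (S j)) by (apply lt_0_INR; lia).
      assert (Hc : K * (C * INR N) ^ N / INR (fact j) = c * INR (S j)).
      { unfold c. rewrite fact_simpl, mult_INR. field. lra. }
      assert (Hk : S (N - S j) = (N - j)%nat) by lia.
      (* The signs e = 1 and e = -1 together bound the absolute value. [psi] is non-decreasing
         because its derivative is [ds] times a quantity that the induction hypothesis makes
         non-negative. *)
      assert (Hgen : forall e, Rabs e = 1 -> e * phi (N - S j)%nat x <= c * (s x - s z0) ^ S j).
      { intros e He.
        set (psi := fun t => c * (s t - s z0) ^ S j - e * phi (N - S j)%nat t).
        assert (Hpsi : psi z0 <= psi x).
        { apply derive_nonneg_le with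
            (fun t => ds t * (c * INR (S j) * (s t - s z0) ^ j - e * phi (N - j)%nat t)); [lra | |].
          - intros t Ht. unfold psi.
            assert (D1 := Hs t ltac:(lra)). assert (D2 := Hphi (N - S j)%nat t ltac:(lra)).
            rewrite Hk in D2.
            evar_last.
            + apply (is_derive_minus (fun t => c * (s t - s z0) ^ S j)
                (fun t => e * phi (N - S j)%nat t)).
              * apply is_derive_scal. apply is_derive_pow.
                apply (is_derive_minus s (fun _ => s z0)); [exact D1 | apply is_derive_const].
              * apply is_derive_scal. exact D2.
            + unfold minus, plus, opp, zero; simpl. ring.
          - intros t Ht. apply Rmult_le_pos; [apply Hds; lra|].
            specialize (IH t ltac:(lia) ltac:(lra)). rewrite Hc in IH.
            assert (e * phi (N - j)%nat t <= Rabs (phi (N - j)%nat t)).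
            { apply Rle_trans with (1 := Rle_abs _). rewrite Rabs_mult, He. lra. }
            lra. }
        unfold psi in Hpsi. rewrite H0 in Hpsi.
        replace (s z0 - s z0) with 0 in Hpsi by ring. rewrite pow_ne_zero in Hpsi by lia. lra. }
      apply Rabs_le. split.
      + specialize (Hgen (-1) ltac:(rewrite Rabs_left; lra)). lra.
      + specialize (Hgen 1 Rabs_R1). lra. }
  set (q := 3 * C * (s z - s z0)).
  assert (Hs0 : s z0 <= s z) by (apply Hmon; lra).
  assert (Hs1 : s z <= s z1) by (apply Hmon; lra).
  assert (Hq : 0 <= q < 1) by (unfold q; split; [apply Rmult_le_pos; lra | nra]).
  assert (HN : forall N, Rabs (phi 0%nat z) <= K * q ^ N).
  { intros N. specialize (Hj N N z (le_n _) Hz). rewrite Nat.sub_diag in Hj.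
    apply Rle_trans with (1 := Hj). unfold q. rewrite !Rpow_mult_distr.
    assert (Hf := INR_fact_lt_0 N). assert (Hp := pow_self_le_fact N).
    assert (0 <= K * C ^ N * (s z - s z0) ^ N)
      by (apply Rmult_le_pos; [apply Rmult_le_pos; [lra | apply pow_le; lra] | apply pow_le; lra]).
    assert (INR N ^ N / INR (fact N) <= 3 ^ N).
    { apply Rmult_le_reg_r with (INR (fact N)); [lra|].
      replace (INR N ^ N / INR (fact N) * INR (fact N)) with (INR N ^ N) by (field; lra). lra. }
    replace (K * (C ^ N * INR N ^ N) / INR (fact N) * (s z - s z0) ^ N)
      with (K * C ^ N * (s z - s z0) ^ N * (INR N ^ N / INR (fact N))) by (field; lra).
    replace (K * (3 ^ N * C ^ N * (s z - s z0) ^ N))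
      with (K * C ^ N * (s z - s z0) ^ N * 3 ^ N) by ring.
    apply Rmult_le_compat_l; lra. }
  assert (Hl : Rabs (phi 0%nat z) <= 0).
  { apply (is_lim_seq_le (fun _ => Rabs (phi 0%nat z)) (fun N => K * q ^ N) (Finite _) (Finite 0) HN).
    - apply is_lim_seq_const.
    - replace (Finite 0) with (Rbar_mult K 0) by (simpl; f_equal; ring).
      apply is_lim_seq_scal_l. apply is_lim_seq_geom. rewrite Rabs_pos_eq; lra. }
  apply Rabs_eq_0. pose proof (Rabs_pos (phi 0%nat z)). lra.
Qed.

(** * Functions represented by power series; uniqueness from the right of 0 *)

(** The identities to be compared are known only for z > 0. Continuity gives a_0 = 0 as a limit from
    the right, and division by z shifts the coefficients; hence [a] is quantified after n. *)
Lemma PSeries_zero_coef (d : R) :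
  0 < d -> forall n a, Rbar_lt (Finite 0) (CV_radius a) ->
  (forall z, 0 < z < d -> PSeries a z = 0) -> a n = 0.
Proof.
  intros Hd. assert (H0 : forall a, Rbar_lt (Finite 0) (CV_radius a) ->
    (forall z, 0 < z < d -> PSeries a z = 0) -> a 0%nat = 0).
  { intros a Ha Hz. destruct (Req_dec (a 0%nat) 0) as [E|E]; [exact E | exfalso].
    assert (Hc : continuity_pt (PSeries a) 0)
      by (apply PSeries_continuity; rewrite Rabs_R0; exact Ha).
    destruct (Hc (Rabs (a 0%nat)) (Rabs_pos_lt _ E)) as (alp & Halp & Hx).
    set (x := Rmin alp d / 2).
    assert (0 < Rmin alp d) by (apply Rmin_pos; lra).
    assert (Rmin alp d <= alp) by apply Rmin_l. assert (Rmin alp d <= d) by apply Rmin_r.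
    specialize (Hx x). unfold dist, D_x, no_cond in Hx. simpl in Hx. unfold R_dist in Hx.
    rewrite PSeries_0, Hz in Hx by (unfold x; lra).
    replace (0 - a 0%nat) with (- a 0%nat) in Hx by ring. rewrite Rabs_Ropp in Hx.
    apply (Rlt_irrefl (Rabs (a 0%nat))). apply Hx. split; [split; [exact I | unfold x; lra]|].
    rewrite Rminus_0_r, Rabs_pos_eq; unfold x; lra. }
  intros n. induction n as [|n IH]; intros a Ha Hz; [apply H0; assumption|].
  change (a (S n)) with (PS_decr_1 a n). apply IH; [rewrite CV_radius_decr_1; exact Ha|].
  intros z Hzd. assert (E := Hz z Hzd). rewrite PSeries_decr_1_aux in E by (apply H0; assumption).
  apply Rmult_integral in E. lra.
Qed.

(** The bound on the radius is not strict, so that the same rho survives sums, products and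
    differentiation. *)
Definition repr (rho : R) (a : nat -> R) (f : R -> R) : Prop :=
  Rbar_le (Finite rho) (CV_radius a) /\ forall x, Rabs x < rho -> PSeries a x = f x.

(** If the radius were smaller, the series would converge at a point outside its disc, halfway to
    rho. *)
Lemma CV_radius_ge (a : nat -> R) (rho : R) :
  (forall x, 0 < x < rho -> ex_pseries a x) -> Rbar_le (Finite rho) (CV_radius a).
Proof.
  intros H. apply Rbar_not_lt_le. intros Hlt. assert (H0 := CV_radius_ge_0 a).
  destruct (CV_radius a) as [c | |] eqn:Ec; simpl in Hlt, H0; try contradiction.
  set (x := (c + rho) / 2). assert (Hx : 0 < x < rho) by (unfold x; lra).
  apply (CV_disk_outside a x).
  - rewrite Ec, Rabs_pos_eq by lra. unfold x; simpl; lra.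
  - specialize (H x Hx). apply ex_series_lim_0.
    apply (ex_series_ext (fun k => scal (pow_n x k) (a k))); [|exact H].
    intros k. rewrite pow_n_pow. unfold scal; simpl; unfold mult; simpl. ring.
Qed.

Lemma repr_in {rho : R} a f x : repr rho a f -> Rabs x < rho -> Rbar_lt (Finite (Rabs x)) (CV_radius a).
Proof. intros [H _] Hx. apply Rbar_lt_le_trans with (2 := H). exact Hx. Qed.

Lemma repr_PSeries {rho : R} a : Rbar_le (Finite rho) (CV_radius a) -> repr rho a (PSeries a).
Proof. intros H. split; [exact H | reflexivity]. Qed.

Lemma repr_mult {rho : R} a b f g :
  repr rho a f -> repr rho b g -> repr rho (PS_mult a b) (fun x => f x * g x).
Proof.
  intros Ha Hb. split.
  - apply CV_radius_ge. intros x Hx. apply ex_pseries_mult.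
    + apply repr_in with (1 := Ha). rewrite Rabs_pos_eq; lra.
    + apply repr_in with (1 := Hb). rewrite Rabs_pos_eq; lra.
  - intros x Hx. rewrite PSeries_mult by eauto using repr_in.
    rewrite (proj2 Ha), (proj2 Hb) by exact Hx. reflexivity.
Qed.

Lemma repr_plus {rho : R} a b f g :
  repr rho a f -> repr rho b g -> repr rho (PS_plus a b) (fun x => f x + g x).
Proof.
  intros Ha Hb. split.
  - apply CV_radius_ge. intros x Hx. apply ex_pseries_plus; apply CV_radius_inside.
    + apply repr_in with (1 := Ha). rewrite Rabs_pos_eq; lra.
    + apply repr_in with (1 := Hb). rewrite Rabs_pos_eq; lra.
  - intros x Hx. rewrite PSeries_plus by (apply CV_radius_inside; eauto using repr_in).
    rewrite (proj2 Ha), (proj2 Hb) by exact Hx. reflexivity.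
Qed.

Lemma repr_scal {rho : R} c a f : repr rho a f -> repr rho (PS_scal c a) (fun x => c * f x).
Proof.
  intros Ha. split.
  - apply CV_radius_ge. intros x Hx. apply ex_pseries_scal; [apply Rmult_comm|].
    apply CV_radius_inside, (repr_in _ _ _ Ha). rewrite Rabs_pos_eq; lra.
  - intros x Hx. rewrite PSeries_scal. rewrite (proj2 Ha) by exact Hx. reflexivity.
Qed.

Lemma repr_incr {rho : R} a f : repr rho a f -> repr rho (PS_incr_1 a) (fun x => x * f x).
Proof.
  intros Ha. split; [rewrite CV_radius_incr_1; apply Ha|].
  intros x Hx. rewrite PSeries_incr_1, (proj2 Ha) by exact Hx. reflexivity.
Qed.

Lemma repr_derive {rho : R} a f : repr rho a f -> repr rho (PS_derive a) (PSeries (PS_derive a)).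
Proof. intros Ha. apply repr_PSeries. rewrite CV_radius_derive. apply Ha. Qed.

Lemma repr_is_derive {rho : R} a f x :
  repr rho a f -> Rabs x < rho -> is_derive f x (PSeries (PS_derive a) x).
Proof.
  intros Ha Hx. apply is_derive_ext_loc with (PSeries a).
  - assert (Hp : 0 < rho - Rabs x) by lra. exists (mkposreal _ Hp). intros y Hy.
    apply (proj2 Ha). change (Rabs (y - x) < rho - Rabs x) in Hy. apply Rabs_def2 in Hy.
    unfold Rabs in *; repeat destruct Rcase_abs; lra.
  - apply is_derive_PSeries. apply repr_in with (1 := Ha) (2 := Hx).
Qed.

Lemma repr_unique {rho : R} a b f g :
  0 < rho -> repr rho a f -> repr rho b g ->
  (forall x, 0 < x < rho -> f x = g x) -> forall n, a n = b n.
Proof.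
  intros Hr Ha Hb H n.
  assert (Hd := repr_plus _ _ _ _ Ha (repr_scal (-1) _ _ Hb)).
  assert (E : PS_plus a (PS_scal (-1) b) n = 0).
  { apply PSeries_zero_coef with rho; [exact Hr | |].
    - apply Rbar_lt_le_trans with (2 := proj1 Hd). exact Hr.
    - intros z Hz. rewrite (proj2 Hd) by (rewrite Rabs_pos_eq; lra). rewrite H by exact Hz. ring. }
  unfold PS_plus, PS_scal, plus, scal in E; simpl in E; unfold mult in E; simpl in E. lra.
Qed.

Lemma repr_Derive_n {rho : R} a f n : 0 < rho -> repr rho a f -> Derive_n f n 0 = a n * INR (fact n).
Proof.
  intros Hr Ha. rewrite <- Derive_n_coef.
  - apply Derive_n_ext_loc. exists (mkposreal _ Hr). intros y Hy. symmetry. apply (proj2 Ha).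
    change (Rabs (y - 0) < rho) in Hy. rewrite Rminus_0_r in Hy. exact Hy.
  - apply Rbar_lt_le_trans with (2 := proj1 Ha). exact Hr.
Qed.

Lemma repr_ext {rho : R} a f g :
  (forall x, Rabs x < rho -> f x = g x) -> repr rho a f -> repr rho a g.
Proof.
  intros H [H1 H2]. split; [exact H1|]. intros x Hx. rewrite H2 by exact Hx. apply H, Hx.
Qed.

Lemma repr_pow {rho : R} a f n :
  repr rho a f -> exists p, repr rho p (fun x => f x ^ S n).
Proof.
  intros H. induction n as [|n [p IH]].
  - exists a. apply repr_ext with (2 := H). intros x _. simpl. ring.
  - exists (PS_mult a p). apply (repr_mult _ _ _ _ H IH).
Qed.

(** * Iterated vector fields and Lagrange's formula *)

(** With g = V / s this is (d/ds)^n b written in the coordinate z; its value at 0 will be n! a_n. *)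
Definition iter_vf (g : nat -> R) (n : nat) (b : nat -> R) : nat -> R :=
  Nat.iter n (fun q => PS_mult g (PS_derive q)) b.

Lemma iter_vf_radius {rho : R} (g b : nat -> R) (n : nat) :
  Rbar_le (Finite rho) (CV_radius g) -> Rbar_le (Finite rho) (CV_radius b) ->
  Rbar_le (Finite rho) (CV_radius (iter_vf g n b)).
Proof.
  intros Hg Hb. induction n as [|n IH]; [exact Hb|].
  apply (repr_mult _ _ _ _ (repr_PSeries _ Hg) (repr_derive _ _ (repr_PSeries _ IH))).
Qed.

(* If s = z / t and g = 1 / s', then g d/dz is d/ds. With h = g b' and H = h t^N one has
   N b' t^(N+1) = N H - z H' + z h' t^N, and the coefficient of z^N in N H - z H' is 0. *)
Lemma lagrange_coef (rho : R) (t g : nat -> R) (tf gf : R -> R) :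
  0 < rho -> repr rho t tf -> repr rho g gf -> tf 0 <> 0 ->
  (forall x, 0 <= x < rho -> gf x * (tf x - x * PSeries (PS_derive t) x) = tf x ^ 2) ->
  forall n b, Rbar_le (Finite rho) (CV_radius b) ->
  iter_vf g (S n) b 0%nat =
    Derive_n (fun z => PSeries (PS_derive b) z * tf z ^ S n) n 0.
Proof.
  intros Hr Ht Hg Ht0 Hrel. assert (HR0 : Rabs 0 < rho) by (rewrite Rabs_R0; lra).
  induction n as [|n IH]; intros b Hb.
  - simpl. rewrite PSeries_0. unfold PS_mult; simpl.
    assert (E := Hrel 0 ltac:(lra)). rewrite <- (proj2 Hg 0 HR0), PSeries_0 in E.
    assert (g 0%nat = tf 0) by (apply Rmult_eq_reg_r with (tf 0); [nra | exact Ht0]). nra.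
  (* Peeling off the innermost derivation makes the induction hypothesis applicable to h = g b'. *)
  - unfold iter_vf. rewrite Nat.iter_succ_r. fold (iter_vf g (S n) (PS_mult g (PS_derive b))).
    set (h := PS_mult g (PS_derive b)).
    assert (Hb' := repr_derive _ _ (repr_PSeries _ Hb)).
    assert (Hh := repr_mult _ _ _ _ Hg Hb'). fold h in Hh.
    assert (Hh' := repr_derive _ _ Hh).
    rewrite IH by apply Hh.
    destruct (repr_pow _ _ n Ht) as [p Hp]. destruct (repr_pow _ _ (S n) Ht) as [p' Hp'].
    assert (H1 := repr_mult _ _ _ _ Hh' Hp). assert (H2 := repr_mult _ _ _ _ Hb' Hp').
    rewrite (repr_Derive_n _ _ n Hr H1), (repr_Derive_n _ _ (S n) Hr H2).
    assert (HH := repr_mult _ _ _ _ Hh Hp).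
    set (N := INR (S n)).
    (* The identity is arranged without differences, as N b' t^(N+1) + z H' = N H + z h' t^N. At
       index n + 1 = N the series z H' has the coefficient N H_N, which cancels against N H. *)
    assert (HL := repr_plus _ _ _ _ (repr_scal N _ _ H2) (repr_incr _ _ (repr_derive _ _ HH))).
    assert (HRt := repr_plus _ _ _ _ (repr_scal N _ _ HH) (repr_incr _ _ H1)).
    assert (E := repr_unique _ _ _ _ Hr HL HRt).
    assert (E' : forall x, 0 < x < rho ->
      N * (PSeries (PS_derive b) x * tf x ^ S (S n)) + x * PSeries (PS_derive (PS_mult h p)) x =
      N * (gf x * PSeries (PS_derive b) x * tf x ^ S n) + x * (PSeries (PS_derive h) x * tf x ^ S n)).
    { intros x Hx0. assert (Hx : Rabs x < rho) by (rewrite Rabs_pos_eq; lra).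
      assert (D1 := repr_is_derive _ _ x HH Hx). assert (D2 := repr_is_derive _ _ x Hh Hx).
      assert (D3 := repr_is_derive _ _ x Ht Hx).
      assert (D4 := is_derive_pow _ (S n) _ _ D3).
      assert (D5 := is_derive_mult _ _ _ _ _ D2 D4 Rmult_comm).
      assert (D6 := eq_trans (eq_sym (is_derive_unique _ _ _ D1)) (is_derive_unique _ _ _ D5)).
      rewrite D6. unfold plus, mult; simpl. fold N.
      specialize (Hrel x ltac:(lra)).
      transitivity (N * tf x ^ n * PSeries (PS_derive b) x * tf x ^ 2 +
        x * (PSeries (PS_derive h) x * (tf x * tf x ^ n) +
         gf x * PSeries (PS_derive b) x * (N * PSeries (PS_derive t) x * tf x ^ n))).
      - unfold N. simpl. ring.
      - rewrite <- Hrel. ring. }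
    specialize (E E' (S n)).
    unfold PS_plus, PS_scal, PS_incr_1, plus, scal in E; simpl in E; unfold mult in E; simpl in E.
    unfold PS_derive at 2 in E. fold N in E.
    rewrite fact_simpl, mult_INR. fold N.
    assert (E2 : PS_mult (PS_derive h) p n = N * PS_mult (PS_derive b) p' (S n)) by lra.
    rewrite E2. ring.
Qed.

(** * Bounds of order k^k on k-th derivatives *)

Lemma Rbar_between (r : R) (c : Rbar) :
  Rbar_lt (Finite r) c -> exists r', r < r' /\ Rbar_lt (Finite r') c.
Proof.
  destruct c as [c | |]; simpl; intros H; try contradiction.
  - exists ((r + c) / 2). lra.
  - exists (r + 1). split; [lra | exact I].
Qed.

Lemma iter_derive_coef (a : nat -> R) (n k : nat) :
  Nat.iter n PS_derive a k = INR (fact (n + k)) / INR (fact k) * a (n + k)%nat.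
Proof.
  revert k. induction n as [|n IH]; intros k.
  - simpl. field. apply INR_fact_neq_0.
  - simpl Nat.iter. unfold PS_derive at 1. rewrite IH.
    replace (n + S k)%nat with (S n + k)%nat by lia.
    rewrite (fact_simpl k), mult_INR. field.
    split; [apply INR_fact_neq_0 | apply not_0_INR; lia].
Qed.

Lemma iter_derive_radius (a : nat -> R) (n : nat) :
  CV_radius (Nat.iter n PS_derive a) = CV_radius a.
Proof. induction n as [|n IH]; [reflexivity | simpl; rewrite CV_radius_derive; exact IH]. Qed.

(** Plain differentiation is the case A = 1 of [maj_iterate]; a radius q0 > q leaves room for the N
    steps. *)
Lemma maj_iter_derive (a : nat -> R) (q : R) :
  0 <= q -> Rbar_lt (Finite q) (CV_radius a) ->
  exists K C, 0 <= K /\ 0 < C /\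
    forall N, maj (Nat.iter N PS_derive a) q (K * (C * INR N) ^ N).
Proof.
  intros Hq Ha. destruct (Rbar_between _ _ Ha) as (q0 & Hq0 & Ha0).
  destruct (maj_exists a q0 ltac:(lra) Ha0) as [M HM].
  destruct (maj_iterate (fun n => Nat.iter n PS_derive a) q0 q M 1) as (C & HC & HN);
    [lra | lra | exact HM | | exists M, C; eauto using maj_nonneg].
  intros k u u' B Hu Hu0 HB.
  change (Nat.iter (S k) PS_derive a) with (PS_derive (Nat.iter k PS_derive a)).
  apply maj_weaken with (3 := maj_derive _ _ _ _ Hu HB); [lra|].
  assert (HB0 := maj_nonneg _ _ _ HB). assert (Hk := pos_INR (S k)).
  replace (B / (u - u')) with (1 / (u - u') * B) by (field; lra).
  apply Rmult_le_compat_r; [exact HB0 | lra].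
Qed.

Lemma maj_iter_vf (g b : nat -> R) (q : R) :
  0 <= q -> Rbar_lt (Finite q) (CV_radius g) -> Rbar_lt (Finite q) (CV_radius b) ->
  exists K C, 0 <= K /\ 0 < C /\ forall N, maj (iter_vf g N b) q (K * (C * INR N) ^ N).
Proof.
  intros Hq Hg Hb. destruct (Rbar_between _ _ Hg) as (q1 & Hq1 & Hg1).
  destruct (Rbar_between _ _ Hb) as (q2 & Hq2 & Hb2).
  destruct (maj_exists g q1 ltac:(lra) Hg1) as [A HA].
  destruct (maj_exists b q2 ltac:(lra) Hb2) as [M HM].
  assert (HA0 := maj_nonneg _ _ _ HA).
  assert (H1 := Rmin_l q1 q2). assert (H2 := Rmin_r q1 q2).
  assert (H3 : q < Rmin q1 q2) by (apply Rmin_glb_lt; lra).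
  destruct (maj_iterate (fun n => iter_vf g n b) (Rmin q1 q2) q M A) as (C & HC & HN);
    [lra | exact HA0 | apply maj_weaken with (3 := HM); lra | |
     exists M, C; eauto using maj_nonneg].
  intros k u u' B Hu Hu0 HB. change (iter_vf g (S k) b) with (PS_mult g (PS_derive (iter_vf g k b))).
  assert (HA' : maj g u' A) by (apply maj_weaken with (3 := HA); lra).
  assert (HB0 := maj_nonneg _ _ _ HB). assert (Hk := pos_INR (S k)).
  apply maj_weaken with (3 := maj_mult _ _ _ _ _ (proj1 Hu) HA' (maj_derive _ _ _ _ Hu HB)); [lra|].
  replace (A * (B / (u - u'))) with (A / (u - u') * B) by (field; lra).
  apply Rmult_le_compat_r; [exact HB0|].
  assert (0 <= A * INR (S k)) by (apply Rmult_le_pos; assumption). lra.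
Qed.

(** The function in the flatness estimate is a difference of two families, each bounded with its own
    constants. *)
Lemma exp_bound_add (K1 C1 K2 C2 : R) (k : nat) :
  0 <= K1 -> 0 <= K2 -> 0 <= C1 -> 0 <= C2 ->
  K1 * (C1 * INR k) ^ k + K2 * (C2 * INR k) ^ k <= (K1 + K2) * ((C1 + C2) * INR k) ^ k.
Proof.
  intros H1 H2 H3 H4. assert (Hk := pos_INR k).
  assert (Hi : forall c, 0 <= c <= C1 + C2 -> (c * INR k) ^ k <= ((C1 + C2) * INR k) ^ k).
  { intros c Hc. apply pow_incr. split; [apply Rmult_le_pos; lra | apply Rmult_le_compat_r; lra]. }
  rewrite Rmult_plus_distr_r.
  apply Rplus_le_compat; apply Rmult_le_compat_l; try assumption; apply Hi; lra.
Qed.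

Lemma radius_of_fact_bound (a : nat -> R) (K C : R) :
  0 <= K -> 0 < C -> (forall n, Rabs (a n) <= K * (C * INR n) ^ n / INR (fact n)) ->
  Rbar_le (Finite (/ (3 * C))) (CV_radius a).
Proof.
  intros HK HC H. apply (proj1 (CV_radius_bounded a)). exists K. intros n.
  assert (H3 : 0 < / (3 * C)) by (apply Rinv_0_lt_compat; lra).
  rewrite Rabs_mult, (Rabs_pos_eq ((/ (3 * C)) ^ n)) by (apply pow_le; lra).
  apply Rle_trans with (K * (C * INR n) ^ n / INR (fact n) * (/ (3 * C)) ^ n).
  - apply Rmult_le_compat_r; [apply pow_le; lra | apply H].
  - assert (Hf := INR_fact_lt_0 n). assert (Hp := pow_self_le_fact n).
    assert (0 < 3 ^ n) by (apply pow_lt; lra). assert (0 < C ^ n) by (apply pow_lt; lra).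
    rewrite pow_inv, !Rpow_mult_distr.
    replace (K * (C ^ n * INR n ^ n) / INR (fact n) * / (3 ^ n * C ^ n))
      with (K * (INR n ^ n / (3 ^ n * INR (fact n)))) by (field; lra).
    rewrite <- (Rmult_1_r K) at 2. apply Rmult_le_compat_l; [exact HK|].
    apply Rmult_le_reg_r with (3 ^ n * INR (fact n)); [apply Rmult_lt_0_compat; lra|].
    replace (INR n ^ n / (3 ^ n * INR (fact n)) * (3 ^ n * INR (fact n))) with (INR n ^ n)
      by (field; lra). lra.
Qed.

(** * The expansion of b in powers of s near 0 *)

(** The coordinate z / t is differentiable up to the endpoint 0, with derivative 1 / g by the
    quotient rule and the relation between t and g. By the choice of [a], the iterates of g d/dz on
    b agree at 0 with the derivatives of omega, so the difference is flat there. *)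
Lemma local_expansion (rho : R) (t g b : nat -> R) :
  0 < rho -> Rbar_le (Finite rho) (CV_radius t) -> Rbar_le (Finite rho) (CV_radius g) ->
  Rbar_le (Finite rho) (CV_radius b) ->
  (forall z, 0 <= z < rho -> 0 < PSeries t z) ->
  (forall z, 0 <= z < rho -> 0 < PSeries g z) ->
  (forall z, 0 <= z < rho ->
     PSeries g z * (PSeries t z - z * PSeries (PS_derive t) z) = PSeries t z ^ 2) ->
  let a := fun n => iter_vf g n b 0%nat / INR (fact n) in
  Rbar_lt (Finite 0) (CV_radius a) /\
  exists d, 0 < d <= rho /\ forall z, 0 < z < d ->
    Rbar_lt (Finite (z / PSeries t z)) (CV_radius a) /\
    PSeries a (z / PSeries t z) = PSeries b z.
Proof.
  intros Hr Ht Hg Hb Htp Hgp Hrel a.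
  assert (Hlt : Rbar_lt (Finite (rho / 2)) (Finite rho)) by (simpl; lra).
  destruct (maj_iter_vf g b (rho / 2) ltac:(lra) (Rbar_lt_le_trans _ _ _ Hlt Hg)
    (Rbar_lt_le_trans _ _ _ Hlt Hb)) as (K1 & C1 & HK1 & HC1 & H1).
  assert (Ha : Rbar_le (Finite (/ (3 * C1))) (CV_radius a)).
  { apply radius_of_fact_bound with K1; [exact HK1 | exact HC1|]. intros n.
    unfold a, Rdiv. rewrite Rabs_mult.
    rewrite (Rabs_pos_eq (/ INR (fact n))) by (left; apply Rinv_0_lt_compat, INR_fact_lt_0).
    apply Rmult_le_compat_r; [left; apply Rinv_0_lt_compat, INR_fact_lt_0|].
    apply Rle_trans with (2 := H1 n 0%nat). simpl. lra. }
  assert (He : 0 < / (3 * C1)) by (apply Rinv_0_lt_compat; lra).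
  set (e := / (3 * C1)) in *.
  assert (Ha2 : Rbar_lt (Finite (e / 2)) (CV_radius a))
    by (apply Rbar_lt_le_trans with (2 := Ha); simpl; lra).
  destruct (maj_iter_derive a (e / 2) ltac:(lra) Ha2) as (K2 & C2 & HK2 & HC2 & H2).
  split; [apply Rbar_lt_le_trans with (2 := Ha); exact He|].
  set (s := fun z => z / PSeries t z).
  assert (Hs : forall z, 0 <= z < rho -> is_derive s z (/ PSeries g z)).
  { intros z Hz. assert (Hz' : Rabs z < rho) by (rewrite Rabs_pos_eq; lra).
    assert (D := repr_is_derive _ _ z (repr_PSeries _ Ht) Hz').
    specialize (Htp z Hz). specialize (Hgp z Hz). specialize (Hrel z Hz).
    evar_last.
    - apply (is_derive_div (fun x => x) (PSeries t) z 1 (PSeries (PS_derive t) z));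
        [apply (is_derive_id (K := R_AbsRing)) | exact D | lra].
    - apply Rmult_eq_reg_l with (PSeries g z * PSeries t z ^ 2);
        [|apply Rgt_not_eq, Rmult_lt_0_compat; [lra | apply pow_lt; lra]].
      transitivity (PSeries g z * (PSeries t z - z * PSeries (PS_derive t) z)); [field; lra|].
      rewrite Hrel. field. lra. }
  assert (Hs0 : s 0 = 0) by (unfold s, Rdiv; ring).
  set (C := C1 + C2).
  (* The bound e / 2 keeps s z where the derivatives of omega are controlled; 1 / (3 C) is the
     smallness required by [flat_vanish]. *)
  set (eta := Rmin (e / 2) (/ (3 * C))).
  assert (HC3 : 0 < / (3 * C)) by (apply Rinv_0_lt_compat; unfold C; lra).
  assert (Heta : 0 < eta) by (apply Rmin_pos; lra).
  assert (Hcont : continuity_pt s 0).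
  { apply continuity_pt_filterlim. apply (ex_derive_continuous s 0).
    exists (/ PSeries g 0). apply Hs. lra. }
  destruct (Hcont eta Heta) as (d1 & Hd1 & Hnear).
  set (d := Rmin d1 (rho / 2)).
  assert (Hdd1 : d <= d1) by apply Rmin_l. assert (Hdr : d <= rho / 2) by apply Rmin_r.
  assert (Hd : 0 < d) by (apply Rmin_pos; lra).
  assert (Hsm : forall z, 0 <= z < d -> 0 <= s z < eta).
  { intros z Hz. assert (Hz0 : 0 <= s z).
    { unfold s. apply Rdiv_le_0_compat; [lra | apply Htp; lra]. }
    split; [exact Hz0|].
    destruct (Req_dec z 0) as [E|E]; [rewrite E, Hs0; exact Heta|].
    specialize (Hnear z). unfold dist, D_x, no_cond in Hnear. simpl in Hnear.
    unfold R_dist in Hnear. rewrite Hs0, !Rminus_0_r in Hnear.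
    rewrite (Rabs_pos_eq (s z) Hz0) in Hnear. apply Hnear.
    split; [split; [exact I | lra] | rewrite Rabs_pos_eq; lra]. }
  exists d. split; [lra|]. intros z Hz. fold (s z).
  assert (Hz1 := Hsm z ltac:(lra)).
  assert (Heta1 : eta <= e / 2) by apply Rmin_l.
  assert (Heta2 : eta <= / (3 * C)) by apply Rmin_r.
  split; [apply Rbar_lt_trans with (2 := Ha2); simpl; lra|].
  set (phi := fun k x => PSeries (iter_vf g k b) x - PSeries (Nat.iter k PS_derive a) (s x)).
  assert (Hv : phi 0%nat z = 0).
  { apply (flat_vanish phi s (fun x => / PSeries g x) 0 z (K1 + K2) C); try (unfold C; lra).
    - intros k x Hx. assert (Hx' : Rabs x < rho) by (rewrite Rabs_pos_eq; lra).
      assert (D1 := repr_is_derive _ _ x (repr_PSeries _ (iter_vf_radius g b k Hg Hb)) Hx').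
      assert (Hsx := Hsm x ltac:(lra)).
      assert (D2 : is_derive (PSeries (Nat.iter k PS_derive a)) (s x)
        (PSeries (Nat.iter (S k) PS_derive a) (s x))).
      { apply is_derive_PSeries. rewrite iter_derive_radius.
        apply Rbar_lt_trans with (2 := Ha2). rewrite Rabs_pos_eq; simpl; lra. }
      assert (D3 := is_derive_comp _ _ _ _ _ D2 (Hs x ltac:(lra))).
      assert (D4 := is_derive_minus _ _ _ _ _ D1 D3).
      evar_last; [exact D4|]. unfold phi.
      change (iter_vf g (S k) b) with (PS_mult g (PS_derive (iter_vf g k b))).
      rewrite (proj2 (repr_mult _ _ _ _ (repr_PSeries _ Hg)
        (repr_derive _ _ (repr_PSeries _ (iter_vf_radius g b k Hg Hb)))) x Hx').
      specialize (Hgp x ltac:(lra)).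
      unfold minus, plus, opp, scal; simpl; unfold mult; simpl. field. lra.
    - intros x Hx. apply Hs. lra.
    - intros x Hx. left. apply Rinv_0_lt_compat, Hgp. lra.
    - intros k. unfold phi. rewrite Hs0, !PSeries_0, iter_derive_coef, Nat.add_0_r.
      unfold a. simpl (fact 0). simpl (INR 1). field. apply INR_fact_neq_0.
    - intros k x Hx. unfold phi, C.
      assert (Hsx := Hsm x ltac:(lra)).
      apply Rle_trans with (2 := exp_bound_add K1 C1 K2 C2 k HK1 HK2 ltac:(lra) ltac:(lra)).
      apply Rle_trans with (1 := Rabs_triang _ _). rewrite Rabs_Ropp.
      apply Rplus_le_compat.
      + apply maj_PSeries with (1 := H1 k). rewrite Rabs_pos_eq; lra.
      + apply maj_PSeries with (1 := H2 k). rewrite Rabs_pos_eq; lra.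
    - rewrite Hs0, Rminus_0_r. apply Rlt_le_trans with (3 * C * / (3 * C)).
      + apply Rmult_lt_compat_l; unfold C in *; lra.
      + right. field. unfold C. lra. }
  unfold phi in Hv. simpl in Hv. lra.
Qed.

(** * Non-negative coefficients and the radius of convergence *)

Lemma is_derive_eps (f : R -> R) (x l eps : R) :
  is_derive f x l -> 0 < eps ->
  exists d, 0 < d /\ forall y, Rabs (y - x) < d -> Rabs (f y - f x) < eps.
Proof.
  intros Hf He. assert (Hc : continuity_pt f x).
  { apply continuity_pt_filterlim. apply (ex_derive_continuous f x). exists l. exact Hf. }
  destruct (proj1 (continuity_pt_locally f x) Hc (mkposreal _ He)) as [d Hd].
  exists d. split; [apply cond_pos | intros y Hy; exact (Hd y Hy)].
Qed.

Lemma PSeries_ge_term (c : nat -> R) (y : R) (m : nat) :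
  (forall n, 0 <= c n) -> 0 <= y -> Rbar_lt (Finite y) (CV_radius c) -> c m * y ^ m <= PSeries c y.
Proof.
  intros Hc Hy Hr. rewrite <- (Rabs_pos_eq y Hy) in Hr.
  assert (H := CV_radius_inside _ _ Hr). apply Series_correct in H.
  assert (E : forall n, 0 <= c n * y ^ n) by (intros; apply Rmult_le_pos; [apply Hc | apply pow_le, Hy]).
  assert (Hterm : forall n, scal (pow_n y n) (c n) = c n * y ^ n).
  { intros n. rewrite pow_n_pow. unfold scal; simpl; unfold mult; simpl. ring. }
  apply (is_series_ext _ (fun n => c n * y ^ n)) in H; [|exact Hterm].
  assert (Hs : is_series (fun n => c n * y ^ n) (PSeries c y)).
  { unfold PSeries. rewrite <- (Series_ext _ _ Hterm). exact H. }
  apply Rle_trans with (sum_n (fun n => c n * y ^ n) m).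
  - destruct m as [|m]; [rewrite sum_O; lra|]. rewrite sum_Sn. unfold plus; simpl plus.
    assert (0 <= sum_n (fun n => c n * y ^ n) m)
      by (rewrite sum_n_Reals; apply sum_f_R0_nonneg; intros; apply E).
    simpl in *. lra.
  - apply (is_lim_seq_incr_compare (sum_n (fun n => c n * y ^ n))); [exact Hs|].
    intros n. rewrite sum_Sn. specialize (E (S n)). unfold plus; simpl in *. lra.
Qed.

Lemma sum_half_pow (n : nat) : sum_f_R0 (fun k => (/ 2) ^ k) n <= 2.
Proof.
  assert (H : sum_f_R0 (fun k => (/ 2) ^ k) n = 2 - (/ 2) ^ n).
  { induction n as [|n IH]; simpl; [lra | rewrite IH; lra]. }
  rewrite H. assert (0 < (/ 2) ^ n) by (apply pow_lt; lra). lra.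
Qed.

(* Pringsheim's argument: the Taylor series at y > 0 has non-negative terms, so its rearrangement
   into a power series at 0 is legitimate wherever it converges. *)
Lemma radius_extend (a : nat -> R) (K c y : R) :
  (forall n, 0 <= a n) -> 0 <= K -> 0 < c -> 0 <= y -> Rbar_lt (Finite y) (CV_radius a) ->
  (forall k, PSeries (Nat.iter k PS_derive a) y <= K * (c * INR k) ^ k) ->
  Rbar_le (Finite (y + / (6 * c))) (CV_radius a).
Proof.
  (* Since 3 c h = 1/2, the k-th term of the binomial expansion of a_n (y + h)^n is at most K / 2^k,
     whatever n is. *)
  intros Ha HK Hc Hy Hr Hb. set (h := / (6 * c)).
  assert (Hh : 0 < h) by (apply Rinv_0_lt_compat; lra).
  apply (proj1 (CV_radius_bounded a)). exists (K * 2). intros n.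
  rewrite Rabs_pos_eq by (apply Rmult_le_pos; [apply Ha | apply pow_le; lra]).
  rewrite (Rplus_comm y h), binomial, scal_sum.
  apply Rle_trans with (K * sum_f_R0 (fun k => (/ 2) ^ k) n);
    [|apply Rmult_le_compat_l; [exact HK | apply sum_half_pow]].
  rewrite scal_sum. apply sum_Rle. intros k Hk.
  assert (Hnn : forall m, 0 <= Nat.iter k PS_derive a m).
  { intros m. rewrite iter_derive_coef. apply Rmult_le_pos; [|apply Ha].
    apply Rdiv_le_0_compat; [apply pos_INR | apply INR_fact_lt_0]. }
  assert (Hr' : Rbar_lt (Finite y) (CV_radius (Nat.iter k PS_derive a)))
    by (rewrite iter_derive_radius; exact Hr).
  (* No double series has to be rearranged: the one term of omega^(k) (y) that contains a_n is at
     most the whole sum, and bounded a_n (y + h)^n suffice for the radius. *)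
  assert (Ht := PSeries_ge_term _ y (n - k) Hnn Hy Hr').
  rewrite iter_derive_coef in Ht. replace (k + (n - k))%nat with n in Ht by lia.
  specialize (Hb k). assert (Hf := INR_fact_lt_0 k). assert (Hp := pow_self_le_fact k).
  assert (Hf' := INR_fact_lt_0 (n - k)).
  assert (Hhk : 0 < h ^ k) by (apply pow_lt, Hh).
  apply Rle_trans with (h ^ k / INR (fact k) * (K * (c * INR k) ^ k)).
  - unfold Binomial.C.
    replace (INR (fact n) / (INR (fact k) * INR (fact (n - k))) * h ^ k * y ^ (n - k) * a n)
      with (h ^ k / INR (fact k) * (INR (fact n) / INR (fact (n - k)) * a n * y ^ (n - k)))
      by (field; lra).
    apply Rmult_le_compat_l; [apply Rdiv_le_0_compat; lra | lra].
  - assert (Hck : 0 < c ^ k) by (apply pow_lt, Hc).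
    assert (H3k : 0 < 3 ^ k) by (apply pow_lt; lra).
    assert (Hhh : h ^ k * c ^ k * 3 ^ k = (/ 2) ^ k)
      by (rewrite <- !Rpow_mult_distr; f_equal; unfold h; field; lra).
    rewrite <- Hhh, Rpow_mult_distr.
    replace (h ^ k / INR (fact k) * (K * (c ^ k * INR k ^ k)))
      with (h ^ k * c ^ k * (INR k ^ k / INR (fact k)) * K) by (field; lra).
    apply Rmult_le_compat_r; [exact HK|].
    apply Rmult_le_compat_l; [apply Rmult_le_pos; lra|].
    apply Rmult_le_reg_r with (INR (fact k)); [lra|].
    replace (INR k ^ k / INR (fact k) * INR (fact k)) with (INR k ^ k) by (field; lra). lra.
Qed.

(** * Derivatives with respect to s away from 0 *)

Definition ps_one (n : nat) : R := match n with 0%nat => 1 | S _ => 0 end.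

Lemma ps_one_radius : CV_radius ps_one = p_infty.
Proof.
  rewrite <- CV_radius_decr_1. rewrite <- CV_radius_const_0. apply CV_radius_ext. reflexivity.
Qed.

Lemma PSeries_one (x : R) : PSeries ps_one x = 1.
Proof.
  rewrite PSeries_decr_1 by (apply CV_radius_inside; rewrite ps_one_radius; exact I).
  rewrite (PSeries_ext _ (fun _ => 0)) by reflexivity. rewrite PSeries_const_0. simpl. ring.
Qed.

(* The k-th derivative of b with respect to s is [PSeries (rel_derive v k)] times b / s^k. *)
Fixpoint rel_derive (v : nat -> R) (k : nat) : nat -> R :=
  match k with
  | 0%nat => ps_one
  | S k' => PS_plus (PS_plus (PS_mult v (PS_derive (rel_derive v k')))
                             (PS_incr_1 (rel_derive v k')))
                    (PS_scal (- INR k') (rel_derive v k'))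
  end.

Lemma repr_rel_derive_S (rho : R) (v : nat -> R) (k : nat) :
  Rbar_le (Finite rho) (CV_radius v) ->
  Rbar_le (Finite rho) (CV_radius (rel_derive v k)) ->
  repr rho (rel_derive v (S k)) (fun x =>
    PSeries v x * PSeries (PS_derive (rel_derive v k)) x +
    x * PSeries (rel_derive v k) x + - INR k * PSeries (rel_derive v k) x).
Proof.
  intros Hv H. assert (H' := repr_PSeries _ H). simpl.
  apply (repr_plus _ _ (fun x => PSeries v x * PSeries (PS_derive (rel_derive v k)) x +
    x * PSeries (rel_derive v k) x) (fun x => - INR k * PSeries (rel_derive v k) x)).
  - apply repr_plus; [|apply repr_incr, H'].
    apply repr_mult; [apply repr_PSeries, Hv | apply (repr_derive _ _ H')].
  - apply repr_scal, H'.
Qed.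

Lemma rel_derive_radius (rho : R) (v : nat -> R) (k : nat) :
  Rbar_le (Finite rho) (CV_radius v) -> Rbar_le (Finite rho) (CV_radius (rel_derive v k)).
Proof.
  intros Hv. induction k as [|k IH]; [simpl; rewrite ps_one_radius; exact I|].
  apply (repr_rel_derive_S rho v k Hv IH).
Qed.

Lemma maj_scal c a r A : 0 <= r -> maj a r A -> maj (PS_scal c a) r (Rabs c * A).
Proof.
  intros Hr H N. apply Rle_trans with (Rabs c * sum_f_R0 (fun n => Rabs (a n) * r ^ n) N).
  - rewrite scal_sum. apply sum_Rle. intros n _.
    unfold PS_scal, scal; simpl; unfold mult; simpl. rewrite Rabs_mult. right. ring.
  - apply Rmult_le_compat_l; [apply Rabs_pos | apply H].
Qed.

Lemma maj_incr a r A : 0 <= r -> maj a r A -> maj (PS_incr_1 a) r (r * A).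
Proof.
  intros Hr H N. assert (HA := maj_nonneg _ _ _ H).
  destruct N as [|N].
  - simpl. unfold zero; simpl. rewrite Rabs_R0. assert (0 <= r * A) by (apply Rmult_le_pos; lra). lra.
  - rewrite decomp_sum by lia. simpl pred. cbn [PS_incr_1].
    unfold zero; simpl. rewrite Rabs_R0, Rmult_0_l, Rplus_0_l.
    apply Rle_trans with (r * sum_f_R0 (fun n => Rabs (a n) * r ^ n) N).
    + rewrite scal_sum. apply sum_Rle. intros n _. right. ring.
    + apply Rmult_le_compat_l; [exact Hr | apply H].
Qed.

Lemma maj_rel_derive (v : nat -> R) (q : R) :
  0 <= q -> Rbar_lt (Finite q) (CV_radius v) ->
  exists K C, 0 <= K /\ 0 < C /\ forall N, maj (rel_derive v N) q (K * (C * INR N) ^ N).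
Proof.
  intros Hq Hv. destruct (Rbar_between _ _ Hv) as (q0 & Hq0 & Hv0).
  destruct (maj_exists v q0 ltac:(lra) Hv0) as [A HA].
  destruct (maj_exists ps_one q0 ltac:(lra)) as [M HM]; [rewrite ps_one_radius; exact I|].
  assert (HA0 := maj_nonneg _ _ _ HA).
  (* The three terms of the recursion cost A / (u - u'), u' <= q0 and k. The scalar k is the reason
     for the summand A (k + 1) in [maj_iterate]. *)
  destruct (maj_iterate (rel_derive v) q0 q M (A + q0 + 1)) as (C & HC & HN);
    [lra | lra | exact HM | | exists M, C; eauto using maj_nonneg].
  intros k u u' B Hu Hu0 HB.
  assert (HA' : maj v u' A) by (apply maj_weaken with (3 := HA); lra).
  assert (HB' : maj (rel_derive v k) u' B) by (apply maj_weaken with (3 := HB); lra).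
  assert (HB0 := maj_nonneg _ _ _ HB).
  assert (Hu' := proj1 Hu).
  assert (H1 := maj_mult _ _ _ _ _ Hu' HA' (maj_derive _ _ _ _ Hu HB)).
  assert (H2 := maj_incr _ _ _ Hu' HB').
  assert (H3 := maj_scal (- INR k) _ _ _ Hu' HB').
  change (rel_derive v (S k)) with (PS_plus (PS_plus (PS_mult v (PS_derive (rel_derive v k)))
    (PS_incr_1 (rel_derive v k))) (PS_scal (- INR k) (rel_derive v k))).
  apply maj_weaken with (3 := maj_plus _ _ _ _ _ Hu' (maj_plus _ _ _ _ _ Hu' H1 H2) H3); [lra|].
  assert (Hk := pos_INR k). rewrite Rabs_Ropp, (Rabs_pos_eq _ Hk).
  replace (A * (B / (u - u')) + u' * B + INR k * B)
    with ((A / (u - u') + u' + INR k) * B) by (field; lra).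
  apply Rmult_le_compat_r; [exact HB0|]. rewrite S_INR.
  assert (A / (u - u') <= (A + q0 + 1) / (u - u')).
  { apply Rmult_le_compat_r; [left; apply Rinv_0_lt_compat; lra | lra]. }
  assert (0 <= (A + q0) * INR k) by (apply Rmult_le_pos; lra). lra.
Qed.

(** * Continuation of the identity along (0, R) *)

(** Strictly inside the disc of convergence, so that all derivatives of omega exist at s z. *)
Definition expansion_at (a : nat -> R) (F G : R -> R) (z : R) : Prop :=
  Rbar_lt (Finite (exp (F z))) (CV_radius a) /\ PSeries a (exp (F z)) = exp (G z).

Lemma exp_le_exp (x y : R) : x <= y -> exp x <= exp y.
Proof.
  intros [H|E]; [left; apply exp_increasing, H | right; rewrite E; reflexivity].
Qed.

Lemma is_derive_exp_comp (F : R -> R) (z l : R) :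
  is_derive F z l -> is_derive (fun x => exp (F x)) z (exp (F z) * l).
Proof.
  intros H. evar_last; [apply (is_derive_comp exp F z); [apply is_derive_exp | exact H]|].
  unfold scal; simpl; unfold mult; simpl. ring.
Qed.

(** Since F' = 1 / V and G' = z / V, applying (V / s) d/dz to p b / s^k gives (V p' + z p - k p) b /
    s^(k+1), which is the recursion of [rel_derive]. *)
Lemma is_derive_rel (rho : R) (v : nat -> R) (F G : R -> R) (k : nat) (z : R) :
  Rbar_le (Finite rho) (CV_radius v) -> Rabs z < rho -> PSeries v z <> 0 ->
  is_derive F z (/ PSeries v z) -> is_derive G z (z / PSeries v z) ->
  is_derive (fun x => PSeries (rel_derive v k) x * exp (G x - INR k * F x)) z
    (PSeries (rel_derive v (S k)) z * exp (G z - INR (S k) * F z) * (exp (F z) * / PSeries v z)).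
Proof.
  intros Hv Hz Hv0 HF HG.
  assert (Hk := rel_derive_radius rho v k Hv).
  assert (D1 := repr_is_derive _ _ z (repr_PSeries _ Hk) Hz).
  assert (D2 : is_derive (fun x => G x - INR k * F x) z (z / PSeries v z - INR k * / PSeries v z)).
  { apply (is_derive_minus G (fun x => INR k * F x)); [exact HG|].
    apply is_derive_scal. exact HF. }
  evar_last; [exact (is_derive_mult _ _ _ _ _ D1 (is_derive_exp_comp _ _ _ D2) Rmult_comm)|].
  rewrite (proj2 (repr_rel_derive_S rho v k Hv Hk) z Hz).
  replace (exp (G z - INR k * F z)) with (exp (G z - INR (S k) * F z) * exp (F z)).
  - unfold plus, mult. cbn -[INR rel_derive]. field. exact Hv0.
  - rewrite <- exp_plus. f_equal. rewrite S_INR. ring.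
Qed.

Lemma is_derive_iter_comp (a : nat -> R) (s : R -> R) (k : nat) (z ds : R) :
  0 < s z -> Rbar_lt (Finite (s z)) (CV_radius a) -> is_derive s z ds ->
  is_derive (fun x => PSeries (Nat.iter k PS_derive a) (s x)) z
    (PSeries (Nat.iter (S k) PS_derive a) (s z) * ds).
Proof.
  intros Hs Hr Hd. evar_last.
  - apply (is_derive_comp (PSeries (Nat.iter k PS_derive a)) s z); [|exact Hd].
    apply is_derive_PSeries. rewrite iter_derive_radius, Rabs_pos_eq by lra. exact Hr.
  - unfold scal; simpl; unfold mult; simpl. ring.
Qed.

(** On an open interval the identity may be differentiated in z, and division by s' = s / V > 0
    raises the order by one. The right side does not mention omega, which makes the derivatives of
    omega accessible to bounds. *)
Lemma iter_derive_eq_rel (rho zs : R) (v a : nat -> R) (F G : R -> R) :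
  zs <= rho -> Rbar_le (Finite rho) (CV_radius v) ->
  (forall z, 0 < z < rho -> 0 < PSeries v z) ->
  (forall z, 0 < z < rho -> is_derive F z (/ PSeries v z)) ->
  (forall z, 0 < z < rho -> is_derive G z (z / PSeries v z)) ->
  (forall z, 0 < z < zs -> expansion_at a F G z) ->
  forall k z, 0 < z < zs -> PSeries (Nat.iter k PS_derive a) (exp (F z)) =
    PSeries (rel_derive v k) z * exp (G z - INR k * F z).
Proof.
  intros Hzs Hv Hpos HF HG Hexp k. induction k as [|k IH]; intros z Hz.
  - simpl. rewrite PSeries_one, (proj2 (Hexp z Hz)).
    replace (G z - 0 * F z) with (G z) by ring. ring.
  - assert (Hv0 := Hpos z ltac:(lra)). assert (HFz := HF z ltac:(lra)).
    assert (D1 := is_derive_rel rho v F G k z Hv ltac:(rewrite Rabs_pos_eq; lra) ltac:(lra)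
      HFz (HG z ltac:(lra))).
    assert (D2 := is_derive_iter_comp a (fun x => exp (F x)) k z _ (exp_pos _)
      (proj1 (Hexp z Hz)) (is_derive_exp_comp _ _ _ HFz)).
    apply is_derive_ext_loc with (g :=
      fun x => PSeries (rel_derive v k) x * exp (G x - INR k * F x)) in D2.
    + assert (D3 := eq_trans (eq_sym (is_derive_unique _ _ _ D2)) (is_derive_unique _ _ _ D1)).
      apply Rmult_eq_reg_r with (2 := Rgt_not_eq _ _ (Rmult_lt_0_compat _ _ (exp_pos (F z))
        (Rinv_0_lt_compat _ Hv0))). exact D3.
    + assert (He : 0 < Rmin z (zs - z)) by (apply Rmin_pos; lra).
      exists (mkposreal _ He). intros y Hy. apply IH.
      assert (H1 := Rmin_l z (zs - z)). assert (H2 := Rmin_r z (zs - z)).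
      change (Rabs (y - z) < Rmin z (zs - z)) in Hy. apply Rabs_def2 in Hy. lra.
Qed.

Lemma continuation_step (rho zs : R) (v a : nat -> R) (F G : R -> R) :
  0 < zs < rho -> Rbar_le (Finite rho) (CV_radius v) ->
  (forall z, 0 < z < rho -> 0 < PSeries v z) ->
  (forall z, 0 < z < rho -> is_derive F z (/ PSeries v z)) ->
  (forall z, 0 < z < rho -> is_derive G z (z / PSeries v z)) ->
  (forall n, 0 <= a n) ->
  (forall z, 0 < z < zs -> expansion_at a F G z) ->
  exists d, 0 < d /\ forall z, zs <= z < zs + d -> expansion_at a F G z.
Proof.
  intros Hzs Hv Hpos HF HG Ha Hexp.
  set (z2 := (zs + rho) / 2).
  assert (Hz2 : zs < z2 < rho) by (unfold z2; lra).
  assert (Hvq : Rbar_lt (Finite ((z2 + rho) / 2)) (CV_radius v))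
    by (apply Rbar_lt_le_trans with (2 := Hv); simpl; lra).
  destruct (maj_rel_derive v ((z2 + rho) / 2) ltac:(lra) Hvq) as (K1 & C1 & HK1 & HC1 & H1).
  set (s := fun z => exp (F z)).
  assert (Hs : forall z, 0 < z < rho -> is_derive s z (s z * / PSeries v z))
    by (intros z Hz; apply is_derive_exp_comp, HF, Hz).
  assert (HFm : forall x y, 0 < x -> x <= y -> y < rho -> F x <= F y).
  { intros x y Hx Hxy Hy. apply derive_nonneg_le with (fun z => / PSeries v z); [exact Hxy | |];
      intros z Hz; [apply HF; lra | left; apply Rinv_0_lt_compat, Hpos; lra]. }
  assert (HGm : forall x y, 0 < x -> x <= y -> y < rho -> G x <= G y).
  { intros x y Hx Hxy Hy. apply derive_nonneg_le with (fun z => z / PSeries v z); [exact Hxy | |];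
      intros z Hz; [apply HG; lra | apply Rdiv_le_0_compat; [lra | apply Hpos; lra]]. }
  (* F and G increase, so exp (G z - k F z) <= exp (G z2) exp (- F (zs / 2))^k on [zs / 2, z2]. The
     left end keeps away from 0, where F need not be bounded below. *)
  set (K2 := K1 * exp (G z2)). set (C2 := C1 * exp (- F (zs / 2))).
  assert (HK2 : 0 <= K2) by (apply Rmult_le_pos; [lra | left; apply exp_pos]).
  assert (HC2 : 0 < C2) by (apply Rmult_lt_0_compat; [lra | apply exp_pos]).
  set (phi1 := fun k z => PSeries (rel_derive v k) z * exp (G z - INR k * F z)).
  assert (Hphi1 : forall k z, zs / 2 <= z <= z2 -> Rabs (phi1 k z) <= K2 * (C2 * INR k) ^ k).
  { intros k z Hz. unfold phi1. rewrite Rabs_mult, (Rabs_pos_eq (exp _)) by (left; apply exp_pos).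
    apply Rle_trans with (K1 * (C1 * INR k) ^ k * (exp (G z2) * exp (- F (zs / 2)) ^ k)).
    - apply Rmult_le_compat; [apply Rabs_pos | left; apply exp_pos | |].
      + apply maj_PSeries with (1 := H1 k). rewrite Rabs_pos_eq; lra.
      + rewrite <- Rpower_pow by apply exp_pos. unfold Rpower. rewrite ln_exp, <- exp_plus.
        apply exp_le_exp. assert (HG2 := HGm z z2 ltac:(lra) ltac:(lra) ltac:(lra)).
        assert (HF2 := HFm (zs / 2) z ltac:(lra) ltac:(lra) ltac:(lra)).
        assert (INR k * F (zs / 2) <= INR k * F z) by (apply Rmult_le_compat_l; [apply pos_INR | lra]).
        lra.
    - right. unfold K2, C2. rewrite !Rpow_mult_distr. ring. }
  assert (Hrel := iter_derive_eq_rel rho zs v a F G (Rlt_le _ _ (proj2 Hzs)) Hv Hpos HF HG Hexp).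
  set (h := / (6 * C2)).
  assert (Hh : 0 < h) by (apply Rinv_0_lt_compat; lra).
  assert (Hrad : Rbar_le (Finite (s zs + h / 2)) (CV_radius a)).
  { destruct (is_derive_eps s zs _ (h / 2) (Hs zs ltac:(lra)) ltac:(lra)) as (d & Hd & Hnear).
    set (z := zs - Rmin d zs / 2).
    assert (Hm1 := Rmin_l d zs). assert (Hm2 := Rmin_r d zs).
    assert (Hm : 0 < Rmin d zs) by (apply Rmin_pos; lra).
    assert (Hz : zs / 2 <= z < zs) by (unfold z; lra).
    assert (Hsz : s z > s zs - h / 2).
    { specialize (Hnear z). rewrite Rabs_left in Hnear by lra.
      specialize (Hnear ltac:(unfold z; lra)). apply Rabs_def2 in Hnear. lra. }
    apply Rbar_le_trans with (Finite (s z + h)); [simpl; lra|].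
    apply radius_extend with K2; try assumption.
    - left. apply exp_pos.
    - apply (Hexp z). lra.
    - intros k. unfold s. rewrite Hrel by lra.
      apply Rle_trans with (1 := Rle_abs _). apply Hphi1. lra. }
  assert (Hsp := exp_pos (F zs)). fold (s zs) in Hsp.
  set (q := s zs + h / 4).
  assert (Hq : Rbar_lt (Finite q) (CV_radius a))
    by (apply Rbar_lt_le_trans with (2 := Hrad); unfold q; simpl; lra).
  destruct (maj_iter_derive a q ltac:(unfold q; lra) Hq) as (K3 & C3 & HK3 & HC3 & H3).
  set (C := C2 + C3). assert (HC : 0 < C) by (unfold C; lra).
  assert (HC6 : 0 < / (6 * C)) by (apply Rinv_0_lt_compat; lra).
  (* The bound h / 4 keeps s below q. Over the interval s varies by less than 2 eta, so 1 / (6 C)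
     ensures the smallness in [flat_vanish]. *)
  set (eta := Rmin (h / 4) (/ (6 * C))).
  assert (Heta : 0 < eta) by (apply Rmin_pos; lra).
  assert (Heta1 : eta <= h / 4) by apply Rmin_l.
  assert (Heta2 : eta <= / (6 * C)) by apply Rmin_r.
  destruct (is_derive_eps s zs _ eta (Hs zs ltac:(lra)) Heta) as (d1 & Hd1 & Hnear).
  set (d := Rmin d1 (Rmin (zs / 2) (z2 - zs))).
  assert (Hd : 0 < d) by (repeat apply Rmin_pos; lra).
  assert (Hdd : d <= d1 /\ d <= zs / 2 /\ d <= z2 - zs).
  { unfold d. assert (A1 := Rmin_l d1 (Rmin (zs / 2) (z2 - zs))).
    assert (A2 := Rmin_r d1 (Rmin (zs / 2) (z2 - zs))).
    assert (A3 := Rmin_l (zs / 2) (z2 - zs)). assert (A4 := Rmin_r (zs / 2) (z2 - zs)). lra. }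
  assert (Hnear' : forall x, zs - d < x < zs + d -> s zs - eta < s x < s zs + eta).
  { intros x Hx. assert (E := Hnear x ltac:(apply Rabs_def1; lra)). apply Rabs_def2 in E. lra. }
  exists d. split; [exact Hd|]. intros z Hz.
  (* Strictly below zs the identity and all its derivatives in s are already known. *)
  set (z0 := zs - d / 2).
  assert (Hin : forall x, z0 <= x <= z -> Rbar_lt (Finite (s x)) (CV_radius a)).
  { intros x Hx. apply Rbar_lt_trans with (2 := Hq). simpl. unfold q.
    assert (E := Hnear' x ltac:(unfold z0 in Hx; lra)). lra. }
  split; [apply Hin; unfold z0; lra|].
  set (phi := fun k x => phi1 k x - PSeries (Nat.iter k PS_derive a) (s x)).
  assert (H0 : phi 0%nat z = 0).
  { apply (flat_vanish phi s (fun x => s x * / PSeries v x) z0 z (K2 + K3) C);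
      try (unfold z0 in *; lra).
    - intros k x Hx. assert (Hxr : 0 < x < rho) by (unfold z0 in Hx; lra).
      assert (D1 := is_derive_rel rho v F G k x Hv ltac:(rewrite Rabs_pos_eq; lra)
        (Rgt_not_eq _ _ (Hpos x Hxr)) (HF x Hxr) (HG x Hxr)).
      assert (D2 := is_derive_iter_comp a s k x _ (exp_pos _) (Hin x Hx) (Hs x Hxr)).
      evar_last; [exact (is_derive_minus _ _ _ _ _ D1 D2)|].
      unfold phi, phi1, s. unfold minus, plus, opp; cbn -[INR rel_derive Nat.iter]. ring.
    - intros x Hx. apply Hs. unfold z0 in Hx; lra.
    - intros x Hx. apply Rmult_le_pos; [left; apply exp_pos|].
      left. apply Rinv_0_lt_compat, Hpos. unfold z0 in Hx; lra.
    - intros k. unfold phi, s. rewrite Hrel by (unfold z0; lra). unfold phi1. ring.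
    - intros k x Hx. unfold phi, C.
      apply Rle_trans with (2 := exp_bound_add K2 C2 K3 C3 k HK2 HK3 ltac:(lra) ltac:(lra)).
      apply Rle_trans with (1 := Rabs_triang _ _). rewrite Rabs_Ropp.
      apply Rplus_le_compat; [apply Hphi1; unfold z0 in Hx; lra|].
      apply maj_PSeries with (1 := H3 k). rewrite Rabs_pos_eq by (left; apply exp_pos).
      assert (E := Hnear' x ltac:(unfold z0 in Hx; lra)). unfold q. lra.
    - assert (E1 := Hnear' z0 ltac:(unfold z0; lra)). assert (E2 := Hnear' z ltac:(lra)).
      apply Rlt_le_trans with (3 * C * (2 * eta)).
      + apply Rmult_lt_compat_l; lra.
      + apply Rle_trans with (6 * C * / (6 * C)); [|right; field; lra].
        replace (3 * C * (2 * eta)) with (6 * C * eta) by ring.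
        apply Rmult_le_compat_l; lra. }
  unfold phi, phi1, s in H0. simpl in H0. rewrite PSeries_one in H0.
  replace (G z - 0 * F z) with (G z) in H0 by ring. lra.
Qed.

(** A supremum argument: the identity holds below the supremum zs of the good initial segments, and
    the local step carries it beyond zs, which is absurd unless z1 is reached. *)
Lemma continuation (z0 : R) (Rr : Rbar) (v a : nat -> R) (F G : R -> R) :
  0 < z0 -> Rbar_le Rr (CV_radius v) ->
  (forall z, 0 < z -> Rbar_lt (Finite z) Rr -> 0 < PSeries v z) ->
  (forall z, 0 < z -> Rbar_lt (Finite z) Rr -> is_derive F z (/ PSeries v z)) ->
  (forall z, 0 < z -> Rbar_lt (Finite z) Rr -> is_derive G z (z / PSeries v z)) ->
  (forall n, 0 <= a n) ->
  (forall z, 0 < z < z0 -> expansion_at a F G z) ->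
  forall z, 0 < z -> Rbar_lt (Finite z) Rr -> expansion_at a F G z.
Proof.
  intros Hz0 Hv Hpos HF HG Ha Hexp z1 Hz1 HzR.
  set (E := fun x => 0 < x <= z1 /\ forall t, 0 < t < x -> expansion_at a F G t).
  assert (Hne : E (Rmin z0 z1)).
  { split; [split; [apply Rmin_pos; lra | apply Rmin_r]|].
    intros t Ht. apply Hexp. assert (A := Rmin_l z0 z1). lra. }
  destruct (completeness E) as [zs [Hub Hlub]].
  - exists z1. intros x Hx. apply Hx.
  - exists (Rmin z0 z1). exact Hne.
  - assert (Hzs0 : 0 < zs) by (apply Rlt_le_trans with (2 := Hub _ Hne), Hne).
    assert (Hzs1 : zs <= z1) by (apply Hlub; intros x Hx; apply Hx).
    assert (Hbelow : forall t, 0 < t < zs -> expansion_at a F G t).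
    { intros t Ht. apply Classical_Prop.NNPP. intros Hn.
      apply (Rlt_not_le zs t); [apply Ht|]. apply Hlub. intros x [Hx Hall].
      apply Rnot_lt_le. intros Hlt. apply Hn, Hall. lra. }
    (* A rho beyond z1 gives the local step room even when zs = z1. *)
    destruct (Rbar_between _ _ HzR) as (rho & Hrho & HrhoR).
    assert (Hlt : forall z, z < rho -> Rbar_lt (Finite z) Rr)
      by (intros z Hz; apply Rbar_lt_trans with (2 := HrhoR); exact Hz).
    destruct (continuation_step rho zs v a F G) as (d & Hd & Hnext).
    + lra.
    + apply Rbar_le_trans with (2 := Hv). apply Rbar_lt_le, HrhoR.
    + intros z Hz. apply Hpos; [lra | apply Hlt; lra].
    + intros z Hz. apply HF; [lra | apply Hlt; lra].
    + intros z Hz. apply HG; [lra | apply Hlt; lra].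
    + exact Ha.
    + exact Hbelow.
    + destruct (Rlt_le_dec z1 (zs + d)) as [Hc|Hc]; [apply Hnext; lra|].
      exfalso. assert (A : zs + d <= zs); [|lra].
      apply Hub. split; [lra|]. intros t Ht.
      destruct (Rlt_le_dec t zs); [apply Hbelow | apply Hnext]; lra.
Qed.

(** * Mean and covariance of the distribution *)

Lemma locally_interval (x : R) (Rr : Rbar) (P : R -> Prop) :
  0 < x -> Rbar_lt (Finite x) Rr ->
  (forall z, 0 < z -> Rbar_lt (Finite z) Rr -> P z) -> locally x P.
Proof.
  intros Hx HxR HP. destruct (Rbar_between _ _ HxR) as (r & Hr & HrR).
  assert (He : 0 < Rmin x (r - x)) by (apply Rmin_pos; lra).
  exists (mkposreal _ He). intros y Hy. change (Rabs (y - x) < Rmin x (r - x)) in Hy.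
  assert (H1 := Rmin_l x (r - x)). assert (H2 := Rmin_r x (r - x)). apply Rabs_def2 in Hy.
  apply HP; [lra | apply Rbar_lt_trans with (2 := HrR); simpl; lra].
Qed.

Lemma psd_mean_expansion (Rr : Rbar) (v a : nat -> R) (F G : R -> R) :
  (forall z, 0 < z -> Rbar_lt (Finite z) Rr -> 0 < PSeries v z) ->
  (forall z, 0 < z -> Rbar_lt (Finite z) Rr -> is_derive F z (/ PSeries v z)) ->
  (forall z, 0 < z -> Rbar_lt (Finite z) Rr -> is_derive G z (z / PSeries v z)) ->
  (forall z, 0 < z -> Rbar_lt (Finite z) Rr -> expansion_at a F G z) ->
  forall z, 0 < z -> Rbar_lt (Finite z) Rr -> psd_mean a (exp (F z)) = z.
Proof.
  intros Hpos HF HG Hexp z Hz HzR.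
  assert (Hp := Hpos z Hz HzR). destruct (Hexp z Hz HzR) as [Hr Hv].
  assert (D1 := is_derive_iter_comp a (fun x => exp (F x)) 0 z _ (exp_pos _) Hr
    (is_derive_exp_comp _ _ _ (HF z Hz HzR))).
  assert (D2 := is_derive_exp_comp _ _ _ (HG z Hz HzR)).
  assert (D3 : is_derive (fun x => exp (G x)) z
    (PSeries (PS_derive a) (exp (F z)) * (exp (F z) * / PSeries v z))).
  { apply is_derive_ext_loc with (2 := D1). apply locally_interval with Rr; [exact Hz | exact HzR |].
    intros y Hy HyR. apply (Hexp y Hy HyR). }
  assert (E := eq_trans (eq_sym (is_derive_unique _ _ _ D3)) (is_derive_unique _ _ _ D2)).
  assert (He := exp_pos (G z)). assert (Hs := exp_pos (F z)).
  unfold psd_mean. rewrite Derive_PSeries by (rewrite Rabs_pos_eq; [exact Hr | lra]).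
  rewrite Hv. apply Rmult_eq_reg_r with (exp (G z) / PSeries v z);
    [|apply Rgt_not_eq, Rdiv_lt_0_compat; lra].
  transitivity (PSeries (PS_derive a) (exp (F z)) * (exp (F z) * / PSeries v z));
    [field; lra | rewrite E; field; lra].
Qed.

(** Each s z is an admissible parameter with mean z, so every left inverse f of the mean coincides
    with s on (0, R). Its derivative is read off from s, without an inverse function theorem. *)
Lemma psd_covariance_expansion (Rr : Rbar) (v a : nat -> R) (F G : R -> R) :
  (forall z, 0 < z -> Rbar_lt (Finite z) Rr -> 0 < PSeries v z) ->
  (forall z, 0 < z -> Rbar_lt (Finite z) Rr -> is_derive F z (/ PSeries v z)) ->
  (forall z, 0 < z -> Rbar_lt (Finite z) Rr -> is_derive G z (z / PSeries v z)) ->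
  (forall z, 0 < z -> Rbar_lt (Finite z) Rr -> expansion_at a F G z) ->
  forall x, 0 < x -> Rbar_lt (Finite x) Rr -> psd_covariance_at a x (PSeries v x).
Proof.
  intros Hpos HF HG Hexp x Hx HxR.
  assert (Hmean := psd_mean_expansion Rr v a F G Hpos HF HG Hexp).
  split.
  - exists (exp (F x)). split; [apply exp_pos | split; [apply (Hexp x Hx HxR) | apply Hmean; assumption]].
  - intros f Hf.
    assert (Hfs : forall z, 0 < z -> Rbar_lt (Finite z) Rr -> exp (F z) = f z).
    { intros z Hz HzR. rewrite <- (Hmean z Hz HzR) at 2. symmetry.
      apply Hf; [apply exp_pos | apply (Hexp z Hz HzR)]. }
    assert (D : is_derive f x (exp (F x) * / PSeries v x)).
    { apply is_derive_ext_loc with (fun z => exp (F z)).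
      - apply locally_interval with Rr; assumption.
      - apply is_derive_exp_comp, HF; assumption. }
    split; [exists (exp (F x) * / PSeries v x); exact D|].
    rewrite (is_derive_unique _ _ _ D), <- (Hfs x Hx HxR).
    assert (Hp := Hpos x Hx HxR). assert (Hs := exp_pos (F x)). field. lra.
Qed.

(** * Behaviour at the origin and conclusion *)

(* The coefficient conditions reflect V(0) = 0 and V'(0) = 1, so V / s = (V / z) t is analytic. *)
Lemma vector_field_at_0 (rho : R) (v t b : nat -> R) (F G : R -> R) :
  0 < rho -> Rbar_le (Finite rho) (CV_radius v) -> Rbar_le (Finite rho) (CV_radius t) ->
  Rbar_le (Finite rho) (CV_radius b) ->
  (forall z, 0 < z < rho -> 0 < PSeries v z) ->
  (forall z, 0 < z < rho -> is_derive F z (/ PSeries v z)) ->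
  (forall z, 0 < z < rho -> is_derive G z (z / PSeries v z)) ->
  (forall z, 0 < z < rho -> PSeries t z = z / exp (F z) /\ PSeries b z = exp (G z)) ->
  0 < t 0%nat ->
  v 0%nat = 0 /\ v 1%nat = 1 /\ b 1%nat = b 0%nat /\
  forall z, 0 < z < rho ->
    PSeries v z * (PSeries t z - z * PSeries (PS_derive t) z) = z * PSeries t z.
Proof.
  intros Hr Hv Ht Hb Hpos HF HG Htb Ht0.
  assert (Rv := repr_PSeries _ Hv). assert (Rt := repr_PSeries _ Ht).
  assert (Rb := repr_PSeries _ Hb).
  assert (Hloc : forall z, 0 < z < rho -> forall P : R -> Prop,
    (forall y, 0 < y < rho -> P y) -> locally z P).
  { intros z Hz P HP. apply locally_interval with (Finite rho); [lra | simpl; lra |].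
    intros y Hy HyR. apply HP. simpl in HyR. lra. }
  (* The logarithmic derivative of t = z / s is z t' / t = 1 - z / V; multiplied out, both sides are
     power series. *)
  assert (E1 : forall z, 0 < z < rho ->
    PSeries v z * (PSeries t z - z * PSeries (PS_derive t) z) = z * PSeries t z).
  { intros z Hz. assert (Hz' : Rabs z < rho) by (rewrite Rabs_pos_eq; lra).
    assert (Hp := Hpos z Hz). assert (Hs := exp_pos (F z)).
    assert (D1 := repr_is_derive _ _ z Rt Hz').
    assert (D2 : is_derive (fun x => x / exp (F x)) z (/ exp (F z) - z * / (exp (F z) * PSeries v z))).
    { evar_last; [apply (is_derive_div (fun x => x) (fun x => exp (F x)) z 1 (exp (F z) * / PSeries v z));
        [apply (is_derive_id (K := R_AbsRing)) | apply is_derive_exp_comp, HF, Hz | lra]|].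
      field. lra. }
    assert (D3 : is_derive (PSeries t) z (/ exp (F z) - z * / (exp (F z) * PSeries v z))).
    { apply is_derive_ext_loc with (2 := D2). apply Hloc; [exact Hz|].
      intros y Hy. symmetry. apply (Htb y Hy). }
    rewrite (eq_trans (eq_sym (is_derive_unique _ _ _ D1)) (is_derive_unique _ _ _ D3)).
    rewrite (proj1 (Htb z Hz)). field. lra. }
  assert (E2 : forall z, 0 < z < rho -> PSeries v z * PSeries (PS_derive b) z = z * PSeries b z).
  { intros z Hz. assert (Hz' : Rabs z < rho) by (rewrite Rabs_pos_eq; lra).
    assert (Hp := Hpos z Hz).
    assert (D1 := repr_is_derive _ _ z Rb Hz').
    assert (D2 : is_derive (PSeries b) z (exp (G z) * (z / PSeries v z))).
    { apply is_derive_ext_loc with (2 := is_derive_exp_comp _ _ _ (HG z Hz)).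
      apply Hloc; [exact Hz|]. intros y Hy. symmetry. apply (Htb y Hy). }
    rewrite (eq_trans (eq_sym (is_derive_unique _ _ _ D1)) (is_derive_unique _ _ _ D2)).
    rewrite (proj2 (Htb z Hz)). field. lra. }
  assert (R1 := repr_mult _ _ _ _ Rv (repr_plus _ _ _ _ Rt
    (repr_scal (-1) _ _ (repr_incr _ _ (repr_derive _ _ Rt))))).
  assert (R2 := repr_incr _ _ Rt).
  assert (R3 := repr_mult _ _ _ _ Rv (repr_derive _ _ Rb)).
  assert (R4 := repr_incr _ _ Rb).
  assert (U1 := repr_unique _ _ _ _ Hr R1 R2).
  assert (U2 := repr_unique _ _ _ _ Hr R3 R4 E2).
  assert (E1' : forall z, 0 < z < rho -> PSeries v z * (PSeries t z + -1 * (z * PSeries (PS_derive t) z))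
     = z * PSeries t z) by (intros z Hz; rewrite <- (E1 z Hz); ring).
  specialize (U1 E1').
  (* The lowest coefficients give v_0 t_0 = 0, then v_1 t_0 = t_0 and v_1 b_1 = b_0; t_0 > 0 allows
     the cancellation. *)
  assert (V0 := U1 0%nat). assert (V1 := U1 1%nat). assert (B1 := U2 1%nat).
  unfold PS_mult, PS_plus, PS_scal, PS_incr_1, PS_derive, plus, scal, zero in V0, V1, B1.
  cbn in V0, V1, B1. unfold mult in V0, V1; simpl in V0, V1.
  assert (v0 : v 0%nat = 0) by (apply Rmult_eq_reg_r with (t 0%nat); lra).
  assert (v1 : v 1%nat = 1) by (rewrite v0 in V1; apply Rmult_eq_reg_r with (t 0%nat); lra).
  rewrite v0, v1 in B1.
  repeat split; try assumption. lra.
Qed.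

Lemma pos_radius_min (c1 c2 c3 : Rbar) (r1 r2 : R) :
  Rbar_lt 0 c1 -> Rbar_lt 0 c2 -> Rbar_lt 0 c3 -> 0 < r1 -> 0 < r2 ->
  exists r, 0 < r /\ Rbar_lt (Finite r) c1 /\ Rbar_lt (Finite r) c2 /\ Rbar_lt (Finite r) c3 /\
    r < r1 /\ r < r2.
Proof.
  intros H1 H2 H3 H4 H5.
  destruct (Rbar_between _ _ H1) as (q1 & P1 & Q1).
  destruct (Rbar_between _ _ H2) as (q2 & P2 & Q2).
  destruct (Rbar_between _ _ H3) as (q3 & P3 & Q3).
  set (r := Rmin q1 (Rmin q2 (Rmin q3 (Rmin r1 r2))) / 2).
  assert (Hr : 0 < 2 * r) by (unfold r; assert (0 < Rmin q1 (Rmin q2 (Rmin q3 (Rmin r1 r2))))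
    by (repeat apply Rmin_pos; lra); lra).
  assert (Hall : 2 * r <= q1 /\ 2 * r <= q2 /\ 2 * r <= q3 /\ 2 * r <= r1 /\ 2 * r <= r2).
  { assert (A1 := Rmin_l q1 (Rmin q2 (Rmin q3 (Rmin r1 r2)))).
    assert (A2 := Rmin_r q1 (Rmin q2 (Rmin q3 (Rmin r1 r2)))).
    assert (A3 := Rmin_l q2 (Rmin q3 (Rmin r1 r2))). assert (A4 := Rmin_r q2 (Rmin q3 (Rmin r1 r2))).
    assert (A5 := Rmin_l q3 (Rmin r1 r2)). assert (A6 := Rmin_r q3 (Rmin r1 r2)).
    assert (A7 := Rmin_l r1 r2). assert (A8 := Rmin_r r1 r2). unfold r. lra. }
  exists r. split; [lra|].
  split; [apply Rbar_lt_trans with (2 := Q1); simpl; lra|].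
  split; [apply Rbar_lt_trans with (2 := Q2); simpl; lra|].
  split; [apply Rbar_lt_trans with (2 := Q3); simpl; lra|]. lra.
Qed.

(* V = PSeries v on the disc of radius Rr; s z = exp (F z), b z = exp (G z)
   with F' = 1/V, G' = z/V on (0,Rr); tau z = z / s z.
   PSeries tc, PSeries bc are the analytic extensions of tau and b at 0. *)
Theorem theorem2 (v : nat -> R) (Rr : Rbar) (F G : R -> R) (tc bc : nat -> R) :
  Rbar_lt (Finite 0) Rr ->
  Rbar_le Rr (CV_radius v) ->
  (forall x, 0 < x -> Rbar_lt (Finite x) Rr -> 0 < PSeries v x) ->
  (forall z, 0 < z -> Rbar_lt (Finite z) Rr -> is_derive F z (/ PSeries v z)) ->
  (forall z, 0 < z -> Rbar_lt (Finite z) Rr -> is_derive G z (z / PSeries v z)) ->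
  Rbar_lt (Finite 0) (CV_radius tc) ->
  Rbar_lt (Finite 0) (CV_radius bc) ->
  (exists d, 0 < d /\
     forall z, 0 < z -> z < d -> Rbar_lt (Finite z) Rr ->
       PSeries tc z = z / exp (F z) /\ PSeries bc z = exp (G z)) ->
  0 < PSeries tc 0 ->
  0 <= PSeries bc 0 ->
  (forall k : nat, (1 <= k)%nat ->
     0 <= / INR (Factorial.fact (k + 1)) *
          Derive_n (fun z => Derive (PSeries bc) z * (PSeries tc z) ^ (k + 1)) k 0) ->
  exists a : nat -> R,
    psd_series a /\
    (forall z, 0 < z -> Rbar_lt (Finite z) Rr ->
       Rbar_lt (Finite (exp (F z))) (CV_radius a) /\ PSeries a (exp (F z)) = exp (G z)) /\
    (forall x, 0 < x -> Rbar_lt (Finite x) Rr -> psd_covariance_at a x (PSeries v x)).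
Proof.
  intros HR Hv Hpos HF HG Ht Hb (d0 & Hd0 & Htb) Htau Hb0 Hc.
  rewrite PSeries_0 in Htau, Hb0.
  assert (Dt : is_derive (PSeries tc) 0 (PSeries (PS_derive tc) 0))
    by (apply is_derive_PSeries; rewrite Rabs_R0; exact Ht).
  destruct (is_derive_eps _ _ _ _ Dt Htau) as (d1 & Hd1 & Hnear).
  destruct (pos_radius_min (CV_radius tc) (CV_radius bc) Rr d0 d1 Ht Hb HR Hd0 Hd1)
    as (rho & Hrho & Hrt & Hrb & HrR & Hrd0 & Hrd1).
  assert (Hlt : forall z, z < rho -> Rbar_lt (Finite z) Rr)
    by (intros z Hz; apply Rbar_lt_trans with (2 := HrR); exact Hz).
  assert (Hrv : Rbar_le (Finite rho) (CV_radius v))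
    by (apply Rbar_le_trans with (2 := Hv); apply Rbar_lt_le, HrR).
  apply Rbar_lt_le in Hrt. apply Rbar_lt_le in Hrb.
  assert (Hposl : forall z, 0 < z < rho -> 0 < PSeries v z)
    by (intros z Hz; apply Hpos; [lra | apply Hlt; lra]).
  assert (Htp : forall z, 0 <= z < rho -> 0 < PSeries tc z).
  { intros z Hz. assert (E := Hnear z ltac:(rewrite Rminus_0_r, Rabs_pos_eq; lra)).
    rewrite PSeries_0 in E. apply Rabs_def2 in E. lra. }
  assert (Htbl : forall z, 0 < z < rho -> PSeries tc z = z / exp (F z) /\ PSeries bc z = exp (G z))
    by (intros z Hz; apply Htb; [lra | lra | apply Hlt; lra]).
  destruct (vector_field_at_0 rho v tc bc F G Hrho Hrv Hrt Hrb Hposl) as (v0 & v1 & b1 & Hvt);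
    [intros z Hz; apply HF; [lra | apply Hlt; lra] | intros z Hz; apply HG; [lra | apply Hlt; lra]
    | exact Htbl | exact Htau |].
  set (g := PS_mult (PS_decr_1 v) tc).
  assert (Rg : repr rho g (fun z => PSeries (PS_decr_1 v) z * PSeries tc z)).
  { apply repr_mult; apply repr_PSeries; [rewrite CV_radius_decr_1; exact Hrv | exact Hrt]. }
  assert (Hw : forall z, 0 < z < rho -> PSeries (PS_decr_1 v) z = PSeries v z / z)
    by (intros z Hz; rewrite (PSeries_decr_1_aux v z v0); field; lra).
  assert (Hg : forall z, 0 <= z < rho -> PSeries g z = PSeries (PS_decr_1 v) z * PSeries tc z)
    by (intros z Hz; apply (proj2 Rg); rewrite Rabs_pos_eq; lra).
  assert (Hg0 : PSeries (PS_decr_1 v) 0 = 1) by (rewrite PSeries_0; exact v1).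
  assert (Hgp : forall z, 0 <= z < rho -> 0 < PSeries g z).
  { intros z Hz. rewrite Hg by exact Hz. apply Rmult_lt_0_compat; [|apply Htp, Hz].
    destruct (Req_dec z 0) as [E|E]; [rewrite E, Hg0; lra|].
    rewrite Hw by lra. apply Rdiv_lt_0_compat; [apply Hposl|]; lra. }
  (* For z > 0 this is the relation between V and t multiplied by t / z; at 0, where V / z is 1, it
     holds trivially. *)
  assert (Hrel : forall z, 0 <= z < rho ->
    PSeries g z * (PSeries tc z - z * PSeries (PS_derive tc) z) = PSeries tc z ^ 2).
  { intros z Hz. rewrite Hg by exact Hz.
    destruct (Req_dec z 0) as [E|E]; [rewrite E, Hg0; ring|].
    rewrite Hw by lra. transitivity (PSeries tc z / z *
      (PSeries v z * (PSeries tc z - z * PSeries (PS_derive tc) z))); [field; lra|].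
    rewrite Hvt by lra. field. lra. }
  set (a := fun n => iter_vf g n bc 0%nat / INR (fact n)).
  destruct (local_expansion rho tc g bc Hrho Hrt (proj1 Rg) Hrb Htp Hgp Hrel)
    as (Har & d & Hd & Hloc). fold a in Har, Hloc.
  assert (Ha : forall n, 0 <= a n).
  { intros n. unfold a. apply Rdiv_le_0_compat; [|apply INR_fact_lt_0].
    destruct n as [|[|m]]; [exact Hb0 | |].
    - change (0 <= g 0%nat * (1 * bc 1%nat)). rewrite Rmult_1_l, b1.
      apply Rmult_le_pos; [|exact Hb0]. unfold g, PS_mult; simpl. unfold PS_decr_1. rewrite v1. lra.
    (* The iterate of order m + 2 at 0 equals (m + 2)! c_(m+1), so its sign is that of c_(m+1). *)
    - rewrite (lagrange_coef rho tc g _ _ Hrho (repr_PSeries _ Hrt) (repr_PSeries _ (proj1 Rg)))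
        by (try exact Hrel; try exact Hrb; rewrite PSeries_0; lra).
      specialize (Hc (S m) ltac:(lia)). replace (S m + 1)%nat with (S (S m)) in Hc by lia.
      rewrite (Derive_n_ext_loc _ (fun z => Derive (PSeries bc) z * PSeries tc z ^ S (S m))).
      + apply Rmult_le_reg_l with (/ INR (fact (S (S m))));
          [apply Rinv_0_lt_compat, INR_fact_lt_0 | rewrite Rmult_0_r; exact Hc].
      + exists (mkposreal _ Hrho). intros y Hy. rewrite Derive_PSeries; [reflexivity|].
        apply Rbar_lt_le_trans with (2 := Hrb). simpl.
        change (Rabs (y - 0) < rho) in Hy. rewrite Rminus_0_r in Hy. exact Hy. }
  assert (Hexp : forall z, 0 < z -> Rbar_lt (Finite z) Rr -> expansion_at a F G z).
  { apply (continuation d Rr v a F G (proj1 Hd) Hv Hpos HF HG Ha).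
    intros z Hz. destruct (Htbl z ltac:(lra)) as [T B].
    assert (Hs := exp_pos (F z)).
    assert (E : z / PSeries tc z = exp (F z)) by (rewrite T; field; lra).
    unfold expansion_at. rewrite <- B, <- E. apply (Hloc z Hz). }
  exists a. split; [split; assumption | split; [exact Hexp|]].
  apply (psd_covariance_expansion Rr v a F G); assumption.
Qed.
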